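(* Let $k$ be a commutative ring with unit, $q\in k^{*}$ and $n\ge 1$. The assignment $$\phi(e_{i(i+1)})=e_{i(i+1)}\otimes 1+1\otimes e_{i(i+1)},\qquad 1\le i\le n,$$ can be extended to a morphism of $k$-algebras $\phi:U\to U\otimes_k U$, where $U=U_q^{+}(sl_{n+1})$ and $U\otimes_k U$ carries the multiplication $(a\otimes b)(c\otimes d)=a\,\sigma(b\otimes c)\,d$.
   Context: **The $T$-Lie algebra $L=(sl_{n+1}^{+})_q$.** Let $e_{ij}$ be the $(n+1)\times(n+1)$ matrix units, and let $L$ be the free $k$-module of strictly upper triangular $(n+1)\times(n+1)$ matrices over $k$, with basis $\mathcal B=\{e_{ij}:1\le i<j\le n+1\}$. Let $[\,,]$ be the usual matrix commutator. For $e_{ij},e_{ab}\in\mathcal B$ let $c_{ij,ab}\in\mathbb Z$ be the integer with $[[e_{ij},e_{ji}],e_{ab}]=c_{ij,ab}e_{ab}$ (over $\mathbb Z$), i.e. $c_{ij,ab}=-\delta_{b,i}+\delta_{b,j}+\delta_{i,a}-\delta_{j,a}$. Order $\mathcal B$ by: $e_{ij}<e_{ab}$ if $i+j<a+b$, or $i+j=a+b$ and $j<b$. - $S:L\otimes_k L\to L\otimes_k L$ is the $k$-linear map with $S(e_{ij}\otimes e_{ab})=q^{c_{ij,ab}}e_{ab}\otimes e_{ij}$ if $e_{ij}<e_{ab}$, $S(e_{ij}\otimes e_{ij})=e_{ij}\otimes e_{ij}$, and $S^2=1$. - The bracket $[\,,]_q:L\otimes_k L\to L$ is the $k$-linear map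 with $[e_{ij},e_{ab}]_q=[e_{ij},e_{ab}]$ if $e_{ij}\le e_{ab}$, and $[\,,]_qS=-[\,,]_q$. - The pseudobracket $\langle\,,\rangle:L\otimes_k L\to L\otimes_k L$ is the $k$-linear map with, for $e_{ij}<e_{ab}$, $\langle e_{ij},e_{ab}\rangle=(q-q^{-1})e_{aj}\otimes e_{ib}$ if $i<a<j<b$ and $0$ otherwise; $\langle e_{ij},e_{ij}\rangle=0$; and $\langle\,,\rangle S=-\langle\,,\rangle$. **The algebra $U$.** Let $\mathcal T$ be the tensor algebra of $L$ over $k$. $U=U_q^{+}(sl_{n+1})$ is the universal enveloping algebra of $L$: the quotient of $\mathcal T$ by the two-sided ideal generated by the elements $x\otimes y-S(x\otimes y)-\langle x,y\rangle-[x,y]_q$, $x,y\in L$. Let $\pi:\mathcal T\to U$ be the projection. Elements of $L$ are also viewed in $U$ via $\pi$. **The map $\sigma$.** Let $\tilde\sigma:\mathcal T\otimes_k\mathcal T\to\mathcal T\otimes_k\mathcal T$ be the $k$-linear map with $\tilde\sigma(z_1\cdots z_r\otimes y_1\cdots y_s)=\big(\prod_{i,j}p_{z_i,y_j}\big)\,y_1\cdots y_s\otimes z_1\cdots z_r$ for $z_i,y_j\in\mathcal B$, where $p_{e_{ij},e_{ab}}=q^{c_{ij,ab}}$. Then $\sigma:U\otimes_k U\to U\otimes_k U$ is the $k$-linear map induced by $\tilde\sigma$, i.e. $\sigma(\pi\otimes\pi)=(\pi\otimes\pi)\tilde\sigma$. In the product $a\,\sigma(b\otimes c)\,d$, the natural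 $U$-bimodule structure of $U\otimes_kU$ is used. *)

(* Defs.v *)
From HB Require Import structures.
From mathcomp Require Import all_boot all_order all_algebra.
From mathcomp Require Import generic_quotient ring_quotient finmap monalg boolp.

Set Implicit Arguments.
Unset Strict Implicit.
Unset Printing Implicit Defensive.

Import GRing.Theory.

Local Open Scope ring_scope.

(* -------------------------------------------------------------------- *)
Section Linear.
Variables (k : comNzRingType) (V W : lmodType k) (f : V -> W).

Definition islin := forall (a : k) (x y : V), f (a *: x + y) = a *: f x + f y.

Hypothesis lf : islin.

Lemma islinD x y : f (x + y) = f x + f y.
Proof. by rewrite -[x]scale1r lf !scale1r. Qed.

Lemma islin0 : f 0 = 0.
Proof. by apply: (@addrI _ (f 0)); rewrite -islinD !addr0. Qed.

Lemma islinZ a x : f (a *: x) = a *: f x.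
Proof. by rewrite -[a *: x]addr0 lf islin0 addr0. Qed.

Lemma islinN x : f (- x) = - f x.
Proof. by rewrite -scaleN1r islinZ scaleN1r. Qed.

Lemma islinB x y : f (x - y) = f x - f y.
Proof. by rewrite islinD islinN. Qed.

Lemma islin_sum (I : Type) (r : seq I) (P : pred I) F :
  f (\sum_(i <- r | P i) F i) = \sum_(i <- r | P i) f (F i).
Proof. by apply: big_morph; [exact: islinD | exact: islin0]. Qed.

End Linear.

Definition bilin (k : comNzRingType) (M N W : lmodType k) (f : M -> N -> W) :=
  (forall y, islin (f^~ y)) /\ (forall x, islin (f x)).

(* -------------------------------------------------------------------- *)
Section Submodule.
Variables (k : comNzRingType) (V : lmodType k).

Record submodule := Submodule {
  smem :> V -> Prop;
  smem0 : smem 0;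
  smemD : forall x y, smem x -> smem y -> smem (x + y);
  smemZ : forall a x, smem x -> smem (a *: x) }.

Lemma smemN (P : submodule) x : P x -> P (- x).
Proof. by move=> Px; rewrite -scaleN1r; apply: smemZ. Qed.

Lemma smemB (P : submodule) x y : P x -> P y -> P (x - y).
Proof. by move=> Px Py; apply: smemD => //; apply: smemN. Qed.

Lemma smem_sum (P : submodule) (I : Type) (r : seq I) (Q : pred I) F :
  (forall i, Q i -> P (F i)) -> P (\sum_(i <- r | Q i) F i).
Proof. by move=> H; apply: big_ind => //; [apply: smem0 | apply: smemD]. Qed.

Variable G : V -> Prop.

Definition span_mem (x : V) : Prop :=
  forall P : submodule, (forall g, G g -> P g) -> P x.

Lemma span_mem0 : span_mem 0. Proof. by move=> P _; apply: smem0. Qed.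
Lemma span_memD x y : span_mem x -> span_mem y -> span_mem (x + y).
Proof. by move=> hx hy P hP; apply: smemD; [apply: hx | apply: hy]. Qed.
Lemma span_memZ a x : span_mem x -> span_mem (a *: x).
Proof. by move=> hx P hP; apply: smemZ; apply: hx. Qed.

Definition span : submodule := Submodule span_mem0 span_memD span_memZ.

End Submodule.

(* -------------------------------------------------------------------- *)
Section QuotientModule.
Variables (k : comNzRingType) (V : lmodType k) (P : submodule V).

Definition smemb : {pred V} := fun x => `[< P x >].

Lemma smemb_zmod : zmod_closed smemb.
Proof.
split; first by apply/asboolP; apply: smem0.
by move=> x y /asboolP Px /asboolP Py; apply/asboolP; apply: smemB.
Qed.

HB.instance Definition _ := GRing.isZmodClosed.Build V smemb smemb_zmod.

Definition lquot : Type := Quotient.quot smemb.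
HB.instance Definition _ := GRing.Zmodule.on lquot.

Definition qpi (x : V) : lquot := (\pi_(Quotient.quot smemb) x)%qT.
Definition qrepr (x : lquot) : V := (repr (x : Quotient.quot smemb))%qT.

Lemma qreprK x : qpi (qrepr x) = x. Proof. exact: reprK. Qed.

Lemma qpi_eq x y : (qpi x = qpi y) <-> P (x - y).
Proof.
split => [/eqP|h]; last apply/eqP.
  by rewrite /qpi -Quotient.idealrBE => /asboolP.
by rewrite /qpi -Quotient.idealrBE; apply/asboolP.
Qed.

Lemma qpiD x y : qpi (x + y) = qpi x + qpi y.
Proof. exact: (Quotient.pi_add _ x y). Qed.

Lemma qrepr_qpi x : P (qrepr (qpi x) - x).
Proof. by apply/qpi_eq; rewrite qreprK. Qed.

Definition qscale (a : k) (x : lquot) : lquot := qpi (a *: qrepr x).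

Lemma qscale_pi a x : qscale a (qpi x) = qpi (a *: x).
Proof. by apply/qpi_eq; rewrite -scalerBr; apply: smemZ; apply: qrepr_qpi. Qed.

Lemma qscaleA a b x : qscale a (qscale b x) = qscale (a * b) x.
Proof. by rewrite -[x]qreprK !qscale_pi scalerA. Qed.
Lemma qscale1 x : qscale 1 x = x.
Proof. by rewrite -[x]qreprK !qscale_pi scale1r. Qed.
Lemma qscaleDr a x y : qscale a (x + y) = qscale a x + qscale a y.
Proof. by rewrite -[x]qreprK -[y]qreprK -qpiD !qscale_pi -qpiD scalerDr. Qed.
Lemma qscaleDl x a b : qscale (a + b) x = qscale a x + qscale b x.
Proof. by rewrite -[x]qreprK !qscale_pi -qpiD scalerDl. Qed.

HB.instance Definition _ := GRing.Zmodule_isLmodule.Build k lquot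
  qscaleA qscale1 qscaleDr qscaleDl.

Lemma qpiZ a x : qpi (a *: x) = a *: qpi x.
Proof. by rewrite -[RHS]/(qscale a _) qscale_pi. Qed.

Lemma qpi_lin : islin qpi.
Proof. by move=> a x y; rewrite qpiD qpiZ. Qed.

Lemma qpi0 : qpi 0 = 0. Proof. exact: islin0 qpi_lin. Qed.

Lemma qpi_eq0 x : qpi x = 0 <-> P x.
Proof. by rewrite -qpi0 qpi_eq subr0. Qed.

End QuotientModule.

(* -------------------------------------------------------------------- *)
Section LinearExtension.
Variables (k : comNzRingType) (K : choiceType) (W : lmodType k).

(* The linear map on the free module with basis K that sends << x >> to h x. *)
Definition mlin (h : K -> W) (g : {malg k[K]}) : W :=
  \sum_(x <- msupp g) g@_x *: h x.

Lemma mlinEw (h : K -> W) (d : {fset K}) (g : {malg k[K]}) :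
  (msupp g `<=` d)%fset -> mlin h g = \sum_(x <- d) g@_x *: h x.
Proof.
move=> le; rewrite /mlin (big_fset_incl _ le) // => x _ /mcoeff_outdom ->.
by rewrite scale0r.
Qed.

Lemma mlin_lin h : islin (mlin h).
Proof.
move=> a x y; pose d := (msupp (a *: x + y) `|` (msupp x `|` msupp y))%fset.
have s1 : (msupp (a *: x + y) `<=` d)%fset by apply: fsubsetUl.
have s2 : (msupp x `<=` d)%fset.
  by apply: fsubset_trans (fsubsetUr _ _); apply: fsubsetUl.
have s3 : (msupp y `<=` d)%fset.
  by apply: fsubset_trans (fsubsetUr _ _); apply: fsubsetUr.
rewrite (mlinEw h s1) (mlinEw h s2) (mlinEw h s3) scaler_sumr -big_split /=.
apply: eq_bigr => z _; rewrite mcoeffD mcoeffZ scalerDl.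
by rewrite (scalerA a (mcoeff z x)).
Qed.

Lemma mlinU h c x : mlin h << c *g x >> = c *: h x.
Proof. by rewrite (mlinEw h msuppU_le) big_seq_fset1 mcoeffUU. Qed.

Lemma mlin1 h x : mlin h << x >> = h x.
Proof. by rewrite mlinU scale1r. Qed.

Lemma malgU_scale (c : k) (x : K) : << c *g x >> = c *: << x >>.
Proof. by apply/malgP => y; rewrite mcoeffZ !mcoeffU mulrnAr mulr1. Qed.

Lemma mlinDf h1 h2 g : mlin (fun x => h1 x + h2 x) g = mlin h1 g + mlin h2 g.
Proof. by rewrite -big_split; apply: eq_bigr => x _; rewrite scalerDr. Qed.

Lemma mlinZf a h g : mlin (fun x => a *: h x) g = a *: mlin h g.
Proof.
rewrite /mlin scaler_sumr; apply: eq_bigr => x _.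
by rewrite scalerA mulrC -scalerA.
Qed.

Lemma malg_ind (P : submodule {malg k[K]}) :
  (forall x, P << x >>) -> forall g, P g.
Proof.
move=> h g; rewrite (monalgE g); apply: smem_sum => x _.
by rewrite malgU_scale; apply: smemZ.
Qed.

End LinearExtension.

Section LinearPredicates.
Variables (k : comNzRingType) (V W : lmodType k).

Lemma scaler_congr2 (a b c d : k) (x : V) :
  a * b = c * d -> a *: (b *: x) = c *: (d *: x).
Proof. by rewrite !scalerA => ->. Qed.

Lemma islin_id : islin (@id V). Proof. by []. Qed.

Lemma islin_zero : islin (fun _ : V => 0 : W).
Proof. by move=> a x y; rewrite scaler0 addr0. Qed.

Lemma islin_sub (f g : V -> W) :
  islin f -> islin g -> islin (fun x => f x - g x).
Proof. by move=> lf lg a x y; rewrite lf lg scalerBr opprD addrACA. Qed.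

Lemma islin_comp (U : lmodType k) (f : V -> W) (g : U -> V) :
  islin f -> islin g -> islin (f \o g).
Proof. by move=> lf lg a x y /=; rewrite lg lf. Qed.

Variables (f g : V -> W).
Hypotheses (lf : islin f) (lg : islin g).

Variable P : submodule W.
Definition preim_mem x := P (f x).
Fact preim0 : preim_mem 0.
Proof. by rewrite /preim_mem (islin0 lf); apply: smem0. Qed.
Fact preimD x y : preim_mem x -> preim_mem y -> preim_mem (x + y).
Proof. by rewrite /preim_mem (islinD lf); apply: smemD. Qed.
Fact preimZ a x : preim_mem x -> preim_mem (a *: x).
Proof. by rewrite /preim_mem (islinZ lf); apply: smemZ. Qed.

Definition preim_submodule : submodule V := Submodule preim0 preimD preimZ.

Definition eqlin_mem x := f x = g x.
Fact eqlin0 : eqlin_mem 0.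
Proof. by rewrite /eqlin_mem (islin0 lf) (islin0 lg). Qed.
Fact eqlinD x y : eqlin_mem x -> eqlin_mem y -> eqlin_mem (x + y).
Proof.
by rewrite /eqlin_mem (islinD lf) (islinD lg) => -> ->.
Qed.
Fact eqlinZ a x : eqlin_mem x -> eqlin_mem (a *: x).
Proof. by rewrite /eqlin_mem (islinZ lf) (islinZ lg) => ->. Qed.

Definition eqlin : submodule V := Submodule eqlin0 eqlinD eqlinZ.

End LinearPredicates.

Lemma malg_eqlin (k : comNzRingType) (K : choiceType) (W : lmodType k)
    (f g : {malg k[K]} -> W) :
  islin f -> islin g -> (forall x, f << x >> = g << x >>) -> f =1 g.
Proof. by move=> lf lg h; apply: (malg_ind (P := eqlin lf lg)). Qed.

(* -------------------------------------------------------------------- *)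
Inductive bilin_rel (k : comNzRingType) (M N : lmodType k) :
  {malg k[(M * N)%type]} -> Prop :=
| BilinL a x x' y :
    bilin_rel (<< (a *: x + x', y) >> - (a *: << (x, y) >> + << (x', y) >>))
| BilinR a x y y' :
    bilin_rel (<< (x, a *: y + y') >> - (a *: << (x, y) >> + << (x, y') >>)).

Definition tensor (k : comNzRingType) (M N : lmodType k) : Type :=
  lquot (span (@bilin_rel k M N)).
HB.instance Definition _ (k : comNzRingType) (M N : lmodType k) :=
  GRing.Lmodule.on (tensor M N).

HB.lock Definition tens (k : comNzRingType) (M N : lmodType k) (x : M) (y : N) :
  tensor M N := qpi (span (@bilin_rel k M N)) << (x, y) >>.

(* The linear map induced by f when f is bilinear; see tliftE. *)
HB.lock Definition tlift (k : comNzRingType) (M N W : lmodType k)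
  (f : M -> N -> W) (t : tensor M N) : W := mlin (fun p => f p.1 p.2) (qrepr t).

Arguments tens {k M N}.
Notation "x ⊗ y" := (tens x y) (at level 40, left associativity) : ring_scope.

Section TensorProduct.
Variables (k : comNzRingType) (M N : lmodType k).
Local Notation rel := (@bilin_rel k M N).

Lemma tens_bilin : bilin (@tens k M N).
Proof.
rewrite tens.unlock.
split=> [y|x] a u v; refine (etrans _ (qpi_lin (span rel) a _ _));
  apply/qpi_eq => P h; apply: h; [exact: BilinL | exact: BilinR].
Qed.

Lemma tens_ind (P : submodule (tensor M N)) :
  (forall x y, P (x ⊗ y)) -> forall t, P t.
Proof.
rewrite tens.unlock => h t; rewrite -[t]qreprK.
pose Q := Submodule (smem := fun g => P (qpi (span rel) g)).
unshelve refine (malg_ind (P := Q _ _ _) _ _).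
- by rewrite qpi0; apply: smem0.
- by move=> x y Px Py; rewrite qpiD; apply: smemD.
- by move=> a x Px; rewrite qpiZ; apply: smemZ.
- by case=> x y; apply: h.
Qed.

Variable W : lmodType k.

Lemma tlift_pi (f : M -> N -> W) : bilin f ->
  forall g, tlift f (qpi _ g) = mlin (fun p => f p.1 p.2) g.
Proof.
rewrite tlift.unlock; case=> lf rf g; set h := fun p => f p.1 p.2.
have lh : islin (mlin h) := mlin_lin h.
have := qrepr_qpi (span rel) g.
move/(_ (eqlin lh (@islin_zero k _ W))) => H; apply/subr0_eq.
rewrite -(islinB lh); apply: H => _ [] *; apply: (etrans (islinB lh _ _)).
  by rewrite lh !mlin1 /h /= lf subrr.
by rewrite lh !mlin1 /h /= rf subrr.
Qed.

Lemma tlift_lin (f : M -> N -> W) : bilin f -> islin (tlift f).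
Proof.
move=> bf a x y; rewrite -[x]qreprK -[y]qreprK -qpiZ -qpiD !tlift_pi //.
exact: mlin_lin.
Qed.

Lemma tliftE (f : M -> N -> W) : bilin f -> forall x y, tlift f (x ⊗ y) = f x y.
Proof. by move=> bf x y; rewrite tens.unlock tlift_pi // mlin1. Qed.

Lemma tliftDf (f g : M -> N -> W) t :
  tlift (fun x y => f x y + g x y) t = tlift f t + tlift g t.
Proof. by rewrite tlift.unlock; apply: mlinDf. Qed.

Lemma tliftZf a (f : M -> N -> W) t :
  tlift (fun x y => a *: f x y) t = a *: tlift f t.
Proof. by rewrite tlift.unlock; apply: mlinZf. Qed.

Lemma eq_tlift (f g : M -> N -> W) :
  (forall x y, f x y = g x y) -> tlift f =1 tlift g.
Proof.
by move=> fg t; rewrite tlift.unlock; apply: eq_bigr => p _; rewrite fg.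
Qed.

Lemma tlift_param (V : lmodType k) (f : V -> M -> N -> W) t :
  (forall x y, islin (fun v => f v x y)) -> islin (fun v => tlift (f v) t).
Proof.
move=> lf a u v; rewrite -tliftZf -tliftDf; apply: eq_tlift => x y; exact: lf.
Qed.

Lemma tens_eqlin (f g : tensor M N -> W) : islin f -> islin g ->
  (forall x y, f (x ⊗ y) = g (x ⊗ y)) -> f =1 g.
Proof. by move=> lf lg h; apply: (tens_ind (P := eqlin lf lg)). Qed.

End TensorProduct.

(* -------------------------------------------------------------------- *)
Section Ideal.
Variables (k : comNzRingType) (A : lalgType k).

Record ideal := Ideal {
  imem :> A -> Prop;
  imem0 : imem 0;
  imemD : forall x y, imem x -> imem y -> imem (x + y);
  imemMl : forall a x, imem x -> imem (a * x);
  imemMr : forall a x, imem x -> imem (x * a) }.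

Lemma imemZ (I : ideal) (a : k) x : I x -> I (a *: x).
Proof. by move=> Ix; rewrite -mulr_algl; apply: imemMl. Qed.

Coercion ideal_submodule (I : ideal) : submodule A :=
  Submodule (imem0 I) (@imemD I) (@imemZ I).

Variable G : A -> Prop.

Definition ideal_gen_mem (x : A) : Prop :=
  forall I : ideal, (forall g, G g -> I g) -> I x.

Fact ideal_gen0 : ideal_gen_mem 0.
Proof. by move=> I _; apply: imem0. Qed.
Fact ideal_genD x y : ideal_gen_mem x -> ideal_gen_mem y -> ideal_gen_mem (x + y).
Proof. by move=> hx hy I hI; apply: imemD; [apply: hx | apply: hy]. Qed.
Fact ideal_genMl a x : ideal_gen_mem x -> ideal_gen_mem (a * x).
Proof. by move=> hx I hI; apply: imemMl; apply: hx. Qed.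
Fact ideal_genMr a x : ideal_gen_mem x -> ideal_gen_mem (x * a).
Proof. by move=> hx I hI; apply: imemMr; apply: hx. Qed.

Definition ideal_gen : ideal :=
  Ideal ideal_gen0 ideal_genD ideal_genMl ideal_genMr.

End Ideal.

Section QuotientRing.
Variables (k : comNzRingType) (A : algType k) (I : ideal A).

Definition aquot : Type := lquot I.
HB.instance Definition _ := GRing.Lmodule.on aquot.

Definition api (x : A) : aquot := qpi I x.
Definition arepr (x : aquot) : A := qrepr x.

Lemma areprK x : api (arepr x) = x. Proof. exact: qreprK. Qed.
Lemma api_lin : islin api. Proof. exact: qpi_lin. Qed.
Lemma api_eq0 x : api x = 0 <-> I x. Proof. exact: qpi_eq0. Qed.
Lemma api_eq x y : api x = api y <-> I (x - y). Proof. exact: qpi_eq. Qed.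
Lemma arepr_api x : I (arepr (api x) - x). Proof. exact: (qrepr_qpi I). Qed.

Definition qone : aquot := api 1.
Definition qmul (x y : aquot) : aquot := api (arepr x * arepr y).

Lemma qmul_pi x y : qmul (api x) (api y) = api (x * y).
Proof.
apply/api_eq; set x' := arepr _; set y' := arepr _.
have -> : x' * y' - x * y = (x' - x) * y' + x * (y' - y).
  by rewrite mulrBl mulrBr addrA subrK.
by apply: imemD; [apply: imemMr | apply: imemMl]; apply: arepr_api.
Qed.

Lemma qmulA : associative qmul.
Proof.
by move=> x y z; rewrite -[x]areprK -[y]areprK -[z]areprK !qmul_pi mulrA.
Qed.
Lemma qmul1q : left_id qone qmul.
Proof. by move=> x; rewrite -[x]areprK qmul_pi mul1r. Qed.
Lemma qmulq1 : right_id qone qmul.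
Proof. by move=> x; rewrite -[x]areprK qmul_pi mulr1. Qed.
Lemma qmulDl : left_distributive qmul +%R.
Proof.
move=> x y z; rewrite -[x]areprK -[y]areprK -[z]areprK.
by rewrite -(islinD api_lin) !qmul_pi mulrDl (islinD api_lin).
Qed.
Lemma qmulDr : right_distributive qmul +%R.
Proof.
move=> x y z; rewrite -[x]areprK -[y]areprK -[z]areprK.
by rewrite -(islinD api_lin) !qmul_pi mulrDr (islinD api_lin).
Qed.

HB.instance Definition _ := GRing.Zmodule_isPzRing.Build aquot
  qmulA qmul1q qmulq1 qmulDl qmulDr.

Lemma apiM x y : api (x * y) = api x * api y.
Proof. by rewrite -[RHS]/(qmul _ _) qmul_pi. Qed.
Lemma api1 : api 1 = 1. Proof. by []. Qed.

Lemma aquot_scalerAl (a : k) (x y : aquot) : a *: (x * y) = (a *: x) * y.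
Proof.
rewrite -[x]areprK -[y]areprK -apiM -!(islinZ api_lin) -apiM.
by rewrite scalerAl.
Qed.
Lemma aquot_scalerAr (a : k) (x y : aquot) : a *: (x * y) = x * (a *: y).
Proof.
rewrite -[x]areprK -[y]areprK -apiM -!(islinZ api_lin) -apiM.
by rewrite scalerAr.
Qed.

End QuotientRing.

(* -------------------------------------------------------------------- *)
(* The tensor algebra of the free module with basis B: words in B form a  *)
(* basis and multiplication is concatenation.                             *)
Section TensorAlgebra.
Variables (k : comNzRingType) (B : choiceType).

Definition tensalg : Type := {malg k[{fmonom B}]}.
HB.instance Definition _ := GRing.Lalgebra.on tensalg.

Definition tword (w : {fmonom B}) : tensalg := << w >>.

Lemma twordM u v : tword u * tword v = tword (mmul u v).
Proof. by rewrite -[LHS]/(fgmul _ _) /tword fgmulUU mulr1. Qed.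

Lemma tensalg_ind (P : submodule tensalg) :
  (forall w, P (tword w)) -> forall x, P x.
Proof. exact: malg_ind. Qed.

Lemma tensalg_eqlin (W : lmodType k) (f g : tensalg -> W) :
  islin f -> islin g -> (forall w, f (tword w) = g (tword w)) -> f =1 g.
Proof. exact: malg_eqlin. Qed.

Lemma tensalg_scalerAr (a : k) (x y : tensalg) : a *: (x * y) = x * (a *: y).
Proof.
apply/malgP => w; rewrite mcoeffZ.
rewrite [RHS](mcoeffMlw w (fsubset_refl _) (msuppZ_le a y)) mcoeffMl mulr_sumr.
apply: eq_bigr => u _; rewrite mulr_sumr; apply: eq_bigr => v _.
by rewrite mcoeffZ mulrnAr mulrCA.
Qed.

HB.instance Definition _ :=
  GRing.Lalgebra_isAlgebra.Build k tensalg tensalg_scalerAr.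

Lemma tword1 : tword mone = 1. Proof. by []. Qed.

End TensorAlgebra.

Section Algebra.
Variables (k : comNzRingType) (A : algType k).

Lemma mulr_islin (x : A) : islin (fun y : A => x * y).
Proof. by move=> a u v; rewrite mulrDr scalerAr. Qed.

Lemma mull_islin (y : A) : islin (fun x : A => x * y).
Proof. by move=> a u v; rewrite mulrDl scalerAl. Qed.

Lemma mul_bilin : bilin (fun x y : A => x * y).
Proof. by split; [exact: mull_islin | exact: mulr_islin]. Qed.

Lemma scaler_swap (a b : k) (x : A) : a *: (b *: x) = b *: (a *: x).
Proof. by rewrite !scalerA mulrC. Qed.

Lemma scaler_mul2 (a b : k) (x y : A) : (a *: x) * (b *: y) = (a * b) *: (x * y).
Proof. by rewrite -scalerAl -scalerAr scalerA. Qed.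
End Algebra.

(* -------------------------------------------------------------------- *)
(* Indices are 0-based: 'I_n.+1 stands for {1, ..., n+1}. Neither the order *)
(* on the basis nor cartan is affected by this shift.                       *)
Section StrictlyUpperTriangular.
Variables (k : comNzRingType) (n : nat).

Definition strictly_upper : {pred 'M[k]_n.+1} :=
  [pred A : 'M[k]_n.+1 | [forall i : 'I_n.+1, forall j : 'I_n.+1, (j <= i)%N ==> (A i j == 0)]].

Lemma strictly_upperP (A : 'M[k]_n.+1) :
  reflect (forall i j : 'I_n.+1, (j <= i)%N -> A i j = 0) (A \in strictly_upper).
Proof.
apply: (iffP forallP) => [h i j le|h i].
  by have /forallP/(_ j)/implyP/(_ le)/eqP := h i.
by apply/forallP => j; apply/implyP => le; rewrite h.
Qed.

Fact strictly_upper_submod : submod_closed strictly_upper.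
Proof.
split; first by apply/strictly_upperP => i j _; rewrite mxE.
move=> a A B /strictly_upperP hA /strictly_upperP hB.
by apply/strictly_upperP => i j le; rewrite !mxE hA // hB // mulr0 addr0.
Qed.

HB.instance Definition _ :=
  GRing.isSubmodClosed.Build k 'M[k]_n.+1 strictly_upper strictly_upper_submod.

Record sut := Sut { sut_val :> 'M[k]_n.+1; sut_valP : sut_val \in strictly_upper }.
HB.instance Definition _ := [isSub for sut_val].
HB.instance Definition _ := [Choice of sut by <:].
HB.instance Definition _ := [SubChoice_isSubLmodule of sut by <:].

Lemma sutP (x : sut) (i j : 'I_n.+1) : (j <= i)%N -> x i j = 0.
Proof. by move: i j; apply/strictly_upperP/sut_valP. Qed.

End StrictlyUpperTriangular.

(* The matrix unit e_ij when i < j, and 0 otherwise. *)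
HB.lock Definition eij (k : comNzRingType) (n : nat) (i j : 'I_n.+1) : sut k n :=
  insubd (0 : sut k n) (delta_mx i j).

Section MatrixUnits.
Variables (k : comNzRingType) (n : nat).
Local Notation sut := (sut k n).
Local Notation eij := (@eij k n).
Local Notation strictly_upper := (@strictly_upper k n).

Lemma eij_val (i j : 'I_n.+1) : (i < j)%N -> eij i j = delta_mx i j :> 'M[k]_n.+1.
Proof.
move=> lt; rewrite eij.unlock val_insubd ifT //; apply/strictly_upperP => a b le.
rewrite mxE; case: eqP => // ea; case: eqP => // eb.
by move: lt; rewrite -ea -eb ltnNge le.
Qed.

Lemma eij0 (i j : 'I_n.+1) : (j <= i)%N -> eij i j = 0.
Proof.
move=> le; apply: val_inj; rewrite eij.unlock val_insubd; case: ifP => //.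
move/strictly_upperP/(_ i j le); rewrite mxE !eqxx => /eqP.
by rewrite oner_eq0.
Qed.

Fact sut_comm_subproof (x y : sut) : x *m y - y *m x \in strictly_upper.
Proof.
have H (u v : sut) : u *m v \in strictly_upper.
  apply/strictly_upperP => i j le; rewrite mxE big1 // => l _.
  case: (leqP l i) => [li|il]; first by rewrite (sutP u li) mul0r.
  by rewrite (sutP v (leq_trans le (ltnW il))) mulr0.
by rewrite rpredB.
Qed.

Definition sut_comm (x y : sut) : sut := Sut (sut_comm_subproof x y).

Lemma eij_comm (i j a b : 'I_n.+1) : (i < j)%N -> (a < b)%N ->
  sut_comm (eij i j) (eij a b) =
  (if j == a then eij i b else 0) - (if b == i then eij a j else 0).
Proof.
move=> ij ab; apply: val_inj; rewrite /= !eij_val // !mul_delta_mx_cond.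
congr (_ - _); case: eqP => [e|_] /=; rewrite ?mulr0n ?mulr1n //.
  by rewrite eij_val //; apply: (ltn_trans ij); rewrite e.
by rewrite eij_val //; apply: (ltn_trans ab); rewrite e.
Qed.

End MatrixUnits.

Section Roots.
Variable n : nat.

(* The index set of the basis of strictly upper triangular matrices. *)
Definition root := {p : 'I_n.+1 * 'I_n.+1 | (p.1 < p.2)%N}.
HB.instance Definition _ := Finite.on root.

Definition rlt (x y : root) : bool :=
  let: (i, j) := val x in let: (a, b) := val y in
  ((i + j < a + b) || (i + j == a + b) && (j < b))%N.

(* c_{ij,ab}; see cartan_commutator. *)
Definition cartan (x y : root) : int :=
  let: (i, j) := val x in let: (a, b) := val y in
  - (b == i)%:R + (b == j)%:R + (i == a)%:R - (j == a)%:R.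

Lemma cartan_commutator (x y : root) :
  let: (i, j) := val x in let: (a, b) := val y in
  let comm (A B : 'M[int]_n.+1) := A *m B - B *m A in
  comm (comm (delta_mx i j) (delta_mx j i)) (delta_mx a b)
  = cartan x y *: delta_mx a b.
Proof.
rewrite /cartan; case: (val x) => i j; case: (val y) => a b /=.
rewrite !mul_delta_mx mulmxBl mulmxBr !mul_delta_mx_cond.
rewrite !scalerDl !scaleNr !scaler_nat.
have M1 : delta_mx i b *+ (i == a) = delta_mx a b *+ (i == a) :> 'M[int]_n.+1.
  by case: eqP => // ->.
have M2 : delta_mx j b *+ (j == a) = delta_mx a b *+ (j == a) :> 'M[int]_n.+1.
  by case: eqP => // ->.
have M3 : delta_mx a i *+ (b == i) = delta_mx a b *+ (b == i) :> 'M[int]_n.+1.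
  by case: eqP => // ->.
have M4 : delta_mx a j *+ (b == j) = delta_mx a b *+ (b == j) :> 'M[int]_n.+1.
  by case: eqP => // ->.
rewrite M1 M2 M3 M4 opprB [LHS]addrC !addrA; congr (_ + _ + _).
by rewrite addrC.
Qed.

End Roots.

Section RootOrder.
Variable n : nat.

Lemma rlt_irr (x : root n) : rlt x x = false.
Proof. by rewrite /rlt; case: (val x) => i j; rewrite !ltnn andbF. Qed.

Lemma rlt_asym (x y : root n) : rlt x y -> rlt y x = false.
Proof.
rewrite /rlt; case: (val x) => i j; case: (val y) => a b.
case/orP => [h|/andP[/eqP-> h]].
  by rewrite ltnNge (ltnW h) /= gtn_eqF.
by rewrite ltnn eqxx /= ltnNge ltnW.
Qed.

Lemma rlt_total (x y : root n) : x != y -> ~~ rlt x y -> rlt y x.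
Proof.
rewrite /rlt => nxy; have : val x != val y by apply: contra nxy => /eqP/val_inj->.
case: (val x) => i j; case: (val y) => a b; rewrite xpair_eqE.
case: (ltngtP (i + j) (a + b)) => //= e; rewrite -leqNgt leq_eqVlt => h.
case/orP => // /eqP/val_inj ebj; move: h e; rewrite ebj eqxx andbT.
by move=> /eqP ne /addIn/val_inj.
Qed.

Lemma cartan_sym (x y : root n) : cartan x y = cartan y x.
Proof.
rewrite /cartan; case: (val x) => i j; case: (val y) => a b.
by rewrite (eq_sym a i) (eq_sym j b) [LHS](ACl (4*2*3*1))%AC.
Qed.

End RootOrder.

(* -------------------------------------------------------------------- *)
Section Basis.
Variables (k : comNzRingType) (n : nat).
Local Notation L := (sut k n).

Definition ebas (x : root n) : L := eij k (val x).1 (val x).2.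
Definition coord (u : L) (x : root n) : k := u (val x).1 (val x).2.

Lemma coord_lin x (a : k) (u v : L) :
  coord (a *: u + v) x = a * coord u x + coord v x.
Proof. by rewrite /coord /= !mxE. Qed.

Lemma coord_ebas x y : coord (ebas x) y = (x == y)%:R.
Proof.
rewrite /coord /ebas eij_val ?(valP x) // mxE.
by rewrite (eq_sym (val y).1) (eq_sym (val y).2).
Qed.

Lemma sut_basis (u : L) : u = \sum_x coord u x *: ebas x.
Proof.
apply: val_inj; apply/matrixP => i j; rewrite raddf_sum summxE /=.
have [le|lt] := leqP j i.
  rewrite sutP // big1 // => x _; rewrite mxE sutP ?mulr0 //.
pose x : root n := Sub (i, j) lt.
have ex y : ebas y i j = (y == x)%:R by exact: (coord_ebas y x).
rewrite (bigD1 x) //= mxE ex eqxx mulr1 big1 ?addr0 // => y /negPf nyx.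
by rewrite mxE ex nyx mulr0.
Qed.

Definition bilext (W : lmodType k) (F : root n -> root n -> W) (u v : L) : W :=
  \sum_x \sum_y (coord u x * coord v y) *: F x y.

Lemma bilext_bilin W F : bilin (@bilext W F).
Proof.
split=> [v|u] a w w'; rewrite /bilext scaler_sumr -big_split /=;
  apply: eq_bigr => x _; rewrite scaler_sumr -big_split /=;
  apply: eq_bigr => y _; rewrite coord_lin scalerA -scalerDl; congr (_ *: _).
  by rewrite mulrDl mulrA.
by rewrite mulrDr mulrCA.
Qed.

Lemma bilext_ebas W F x y : @bilext W F (ebas x) (ebas y) = F x y.
Proof.
rewrite /bilext (bigD1 x) //= [X in _ + X]big1 => [|z /negPf nz].
  rewrite addr0 (bigD1 y) //= [X in _ + X]big1 => [|z /negPf nz].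
    by rewrite !coord_ebas !eqxx mulr1 scale1r addr0.
  by rewrite !coord_ebas eq_sym nz mulr0 scale0r.
by rewrite big1 // => t _; rewrite coord_ebas eq_sym nz mul0r scale0r.
Qed.

(* The linear map on L ⊗ L with prescribed values on basis tensors. *)
Definition blift (W : lmodType k) (F : root n -> root n -> W) : tensor L L -> W :=
  tlift (bilext F).

Lemma blift_lin W F : islin (@blift W F).
Proof. exact/tlift_lin/bilext_bilin. Qed.

Lemma blift_ebas W F x y : @blift W F (ebas x ⊗ ebas y) = F x y.
Proof. by rewrite /blift tliftE ?bilext_ebas //; apply: bilext_bilin. Qed.

Lemma tens_basis (u v : L) :
  u ⊗ v = \sum_x \sum_y (coord u x * coord v y) *: (ebas x ⊗ ebas y).
Proof.
have [lf rf] := tens_bilin L L.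
rewrite {1}[u]sut_basis (islin_sum (lf v)); apply: eq_bigr => x _.
rewrite {1}[v]sut_basis (islinZ (lf _)) (islin_sum (rf _)) scaler_sumr.
by apply: eq_bigr => y _; rewrite (islinZ (rf _)) scalerA.
Qed.

Lemma LL_eqlin (W : lmodType k) (f g : tensor L L -> W) : islin f -> islin g ->
  (forall x y, f (ebas x ⊗ ebas y) = g (ebas x ⊗ ebas y)) -> f =1 g.
Proof.
move=> lf lg h; apply: tens_eqlin => // u v.
rewrite tens_basis !(islin_sum lf, islin_sum lg); apply: eq_bigr => x _.
rewrite !(islin_sum lf, islin_sum lg); apply: eq_bigr => y _.
by rewrite (islinZ lf) (islinZ lg) h.
Qed.

End Basis.


(* -------------------------------------------------------------------- *)
Section TLieAlgebra.
Variables (k : comUnitRingType) (q : k) (n : nat).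
Local Notation L := (sut k n).
Local Notation e := (@ebas k n).

Definition qS_basis (x y : root n) : tensor L L :=
  if x == y then e x ⊗ e x
  else if rlt x y then q ^ cartan x y *: (e y ⊗ e x)
  else q ^ (- cartan y x) *: (e y ⊗ e x).

Definition qS : tensor L L -> tensor L L := blift qS_basis.

(* The values on all basis tensors of the map that agrees with F on those *)
(* with x < y, vanishes on those with x = y, and satisfies f \o S = - f.   *)
Definition skew (W : lmodType k) (F : root n -> root n -> W) (x y : root n) : W :=
  if x == y then 0
  else if rlt x y then F x y
  else - (q ^ (- cartan y x) *: F y x).

Definition qbracket : tensor L L -> L :=
  blift (skew (fun x y => sut_comm (e x) (e y))).

Definition pseudo_lt (x y : root n) : tensor L L :=
  let: (i, j) := val x in let: (a, b) := val y in
  if [&& i < a, a < j & j < b]%N then (q - q^-1) *: (eij k a j ⊗ eij k i b)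
  else 0.

Definition qpseudo : tensor L L -> tensor L L := blift (skew pseudo_lt).

Lemma qS_lt x y : rlt x y -> qS (e x ⊗ e y) = q ^ cartan x y *: (e y ⊗ e x).
Proof.
move=> lt; rewrite /qS blift_ebas /qS_basis lt; case: eqP => // exy.
by rewrite exy rlt_irr in lt.
Qed.

Lemma qS_diag x : qS (e x ⊗ e x) = e x ⊗ e x.
Proof. by rewrite /qS blift_ebas /qS_basis eqxx. Qed.

Lemma qS_gt x y : rlt y x -> qS (e x ⊗ e y) = q ^ (- cartan y x) *: (e y ⊗ e x).
Proof.
move=> lt; rewrite /qS blift_ebas /qS_basis rlt_asym //; case: eqP => // exy.
by rewrite exy rlt_irr in lt.
Qed.

Lemma qS_lin : islin qS. Proof. exact: blift_lin. Qed.

Lemma skew_S (W : lmodType k) (F : root n -> root n -> W) :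
  q \is a GRing.unit -> forall t, blift (skew F) (qS t) = - blift (skew F) t.
Proof.
move=> uq t; set f := blift _; have lf : islin f := blift_lin _.
rewrite -(islinN lf); have lN : islin (fun t => f (- t)).
  by move=> a u v; rewrite !(islinN lf) lf opprD scalerN.
apply: (LL_eqlin (f := f \o qS) _ lN) => [|x y]; first exact: islin_comp qS_lin.
rewrite /= (islinN lf); have [<-|nxy] := eqVneq x y.
  by rewrite qS_diag /f blift_ebas /skew eqxx oppr0.
have [lt|/(rlt_total nxy) gt] := boolP (rlt x y).
  rewrite qS_lt // (islinZ lf) /f !blift_ebas /skew lt eq_sym (negPf nxy).
  by rewrite rlt_asym // scalerN scalerA -exprzDr // subrr expr0z scale1r.
rewrite qS_gt // (islinZ lf) /f !blift_ebas /skew gt eq_sym (negPf nxy).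
by rewrite rlt_asym // opprK.
Qed.

Lemma qS_invol : q \is a GRing.unit -> forall t, qS (qS t) = t.
Proof.
move=> uq; apply: (LL_eqlin (f := qS \o qS) (g := id)) => [||x y] /=.
- exact: islin_comp qS_lin qS_lin.
- by [].
have [<-|nxy] := eqVneq x y; first by rewrite !qS_diag.
have [lt|/(rlt_total nxy) gt] := boolP (rlt x y).
  rewrite qS_lt // (islinZ qS_lin) qS_gt // scalerA -exprzDr // subrr.
  by rewrite expr0z scale1r.
rewrite qS_gt // (islinZ qS_lin) qS_lt // scalerA -exprzDr // addNr.
by rewrite expr0z scale1r.
Qed.

Lemma qbracket_le x y :
  (x == y) || rlt x y -> qbracket (e x ⊗ e y) = sut_comm (e x) (e y).
Proof.
rewrite /qbracket blift_ebas /skew; case: eqP => [<- _|_ /= -> //].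
by apply: val_inj; rewrite /= subrr.
Qed.

Lemma qbracket_S : q \is a GRing.unit -> forall t, qbracket (qS t) = - qbracket t.
Proof. exact: skew_S. Qed.

Lemma qpseudo_lt x y : rlt x y -> qpseudo (e x ⊗ e y) = pseudo_lt x y.
Proof.
move=> lt; rewrite /qpseudo blift_ebas /skew lt; case: eqP => // exy.
by rewrite exy rlt_irr in lt.
Qed.

Lemma qpseudo_diag x : qpseudo (e x ⊗ e x) = 0.
Proof. by rewrite /qpseudo blift_ebas /skew eqxx. Qed.

Lemma qpseudo_S : q \is a GRing.unit -> forall t, qpseudo (qS t) = - qpseudo t.
Proof. exact: skew_S. Qed.

(* ------------------------------------------------------------------ *)
Local Notation T := (tensalg k (root n)).

Definition tgen (x : root n) : T := tword k (fmu x).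

Definition iota_T (u : L) : T := \sum_x coord u x *: tgen x.

Definition mul_LL : tensor L L -> T := tlift (fun u v => iota_T u * iota_T v).

Definition uea_relator (t : tensor L L) : T :=
  mul_LL t - mul_LL (qS t) - mul_LL (qpseudo t) - iota_T (qbracket t).

Definition uea_rel (g : T) : Prop := exists u v : L, g = uea_relator (u ⊗ v).

Definition uea_ideal : ideal T := ideal_gen uea_rel.

Definition Uq : Type := aquot uea_ideal.
HB.instance Definition _ := GRing.PzRing.on Uq.
HB.instance Definition _ := GRing.Lmodule.on Uq.

Lemma iota_T_lin : islin iota_T.
Proof.
move=> a u v; rewrite /iota_T scaler_sumr -big_split; apply: eq_bigr => x _ /=.
by rewrite coord_lin scalerDl scalerA.
Qed.

Lemma iota_T_ebas x : iota_T (e x) = tgen x.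
Proof.
rewrite /iota_T (bigD1 x) //= coord_ebas eqxx scale1r big1 ?addr0 // => y.
by rewrite coord_ebas eq_sym => /negPf ->; rewrite scale0r.
Qed.

(* With iota_T, T has the universal property of the tensor algebra of L. *)
Lemma tensalg_universal (A : algType k) (f : L -> A) : islin f ->
  exists2 g : {lrmorphism T -> A}, forall u, g (iota_T u) = f u
    & forall h : {lrmorphism T -> A}, (forall u, h (iota_T u) = f u) -> h =1 g.
Proof.
move=> lf.
pose p (w : {fmonom root n}) : A := \prod_(x <- (w : seq (root n))) f (e x).
pose g (x : T) : A := mlin p x.
have lg : islin g := mlin_lin p.
have gw w : g (tword k w) = p w by exact: mlin1.
have gM : {morph g : x y / x * y}.
  have [lT rT] := mul_bilin T; have [lA rA] := mul_bilin A => x y; move: x.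
  apply: tensalg_eqlin => [||u].
  - exact: islin_comp lg (lT y).
  - exact: islin_comp (lA _) lg.
  move: y; apply: tensalg_eqlin => [||v].
  - exact: islin_comp lg (rT _).
  - exact: islin_comp (rA _) lg.
  by rewrite twordM !gw /p fmM big_cat.
have g1 : g 1 = 1 by rewrite -tword1 gw /p fm1 big_nil.
have gB : zmod_morphism g by move=> x y; apply: islinB.
have gMM : monoid_morphism g by [].
have gZ : scalable g by move=> a x; apply: islinZ.
pose ga := GRing.isZmodMorphism.Build T A g gB.
pose gm := GRing.isMonoidMorphism.Build T A g gMM.
pose gs := GRing.isScalable.Build k T A *:%R g gZ.
pose G : {lrmorphism T -> A} := HB.pack g ga gm gs.
exists G => [u|h hf x] /=.
  rewrite /iota_T (islin_sum lg) [u in RHS]sut_basis (islin_sum lf).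
  apply: eq_bigr => x _; rewrite (islinZ lg) (islinZ lf); congr (_ *: _).
  by rewrite gw /p fmU big_seq1.
have lh : islin h by move=> a y z; rewrite linearP.
move: x; apply: tensalg_eqlin => // w.
rewrite -[RHS]/(g _) gw /p -[w]fmK; case: w => s /=.
elim: s => [|x s IHs]; first by rewrite -fmoneE tword1 rmorph1 big_nil.
have -> : FMonom (x :: s) = mmul (fmu x) (FMonom s).
  by rewrite -[RHS]/(fmmul _ _) fmmulE fmuE.
rewrite -twordM rmorphM /= IHs big_cons; congr (_ * _).
by rewrite -hf iota_T_ebas.
Qed.

Lemma mul_LL_bilin : bilin (fun u v => iota_T u * iota_T v).
Proof.
have [l r] := mul_bilin T; split=> [v|u].
  exact: islin_comp (l (iota_T v)) iota_T_lin.
exact: islin_comp (r (iota_T u)) iota_T_lin.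
Qed.

Lemma mul_LLE u v : mul_LL (u ⊗ v) = iota_T u * iota_T v.
Proof. exact: tliftE mul_LL_bilin _ _. Qed.

Lemma mul_LL_lin : islin mul_LL.
Proof. exact: tlift_lin mul_LL_bilin. Qed.

Lemma qbracket_lin : islin qbracket. Proof. exact: blift_lin. Qed.
Lemma qpseudo_lin : islin qpseudo. Proof. exact: blift_lin. Qed.

Lemma uea_relator_lin : islin uea_relator.
Proof.
apply: islin_sub; last exact: islin_comp iota_T_lin qbracket_lin.
apply: islin_sub; last exact: islin_comp mul_LL_lin qpseudo_lin.
by apply: islin_sub; [exact: mul_LL_lin | exact: islin_comp mul_LL_lin qS_lin].
Qed.

(* ------------------------------------------------------------------ *)
(* The augmentation shows that U is nonzero, as MathComp requires of an *)
(* algType.                                                             *)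
Lemma mcoeff1M (x y : T) : mcoeff mone (x * y) = mcoeff mone x * mcoeff mone y.
Proof. exact: (mcoeff1g_is_multiplicative _ _).1. Qed.

Lemma mcoeff1B (x y : T) : mcoeff mone (x - y) = mcoeff mone x - mcoeff mone y.
Proof. exact: mcoeffB. Qed.

Lemma mcoeff1_iota_T u : mcoeff mone (iota_T u) = 0.
Proof.
rewrite raddf_sum big1 //= => x _; rewrite mcoeffZ mcoeffU1.
by rewrite -val_eqE /= fmU fm1 mulr0.
Qed.

Lemma mcoeff1_mul_LL t : mcoeff mone (mul_LL t) = 0.
Proof.
have lz := @islin_zero k (tensor L L) k^o.
have lf : islin (fun t => mcoeff mone (mul_LL t) : k^o).
  by move=> a u v; rewrite mul_LL_lin mcoeffD mcoeffZ.
apply: (tens_eqlin lf lz) => u v; rewrite mul_LLE mcoeff1M mcoeff1_iota_T.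
exact: (mul0r (_ : k)).
Qed.

Fact aug0 : mcoeff mone (0 : T) = 0. Proof. exact: mcoeff0. Qed.
Fact augD (x y : T) : mcoeff mone x = 0 -> mcoeff mone y = 0 ->
  mcoeff mone (x + y) = 0.
Proof. by rewrite mcoeffD => -> ->; rewrite addr0. Qed.
Fact augMl (a x : T) : mcoeff mone x = 0 -> mcoeff mone (a * x) = 0.
Proof. by rewrite mcoeff1M => ->; rewrite mulr0. Qed.
Fact augMr (a x : T) : mcoeff mone x = 0 -> mcoeff mone (x * a) = 0.
Proof. by rewrite mcoeff1M => ->; rewrite mul0r. Qed.
Definition aug_ideal : ideal T := Ideal aug0 augD augMl augMr.

Lemma uea_ideal_aug x : uea_ideal x -> mcoeff mone x = 0.
Proof.
move=> /(_ aug_ideal); apply=> _ [u [v ->]] /=.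
rewrite /uea_relator mcoeff1B mcoeff1_iota_T subr0 mcoeff1B mcoeff1_mul_LL.
by rewrite mcoeff1B !mcoeff1_mul_LL !subr0.
Qed.

Fact Uq_1neq0 : (1 : Uq) != 0.
Proof.
apply/eqP => /(api_eq0 uea_ideal) /uea_ideal_aug /eqP.
by rewrite (rmorph1 (mcoeff mone)) oner_eq0.
Qed.

HB.instance Definition _ := GRing.PzSemiRing_isNonZero.Build Uq Uq_1neq0.
HB.instance Definition _ :=
  GRing.Lmodule_isLalgebra.Build k Uq (@aquot_scalerAl k T uea_ideal).
HB.instance Definition _ :=
  GRing.Lalgebra_isAlgebra.Build k Uq (@aquot_scalerAr k T uea_ideal).

Definition piU (x : T) : Uq := api uea_ideal x.

(* The elements of L viewed in U. *)
Definition inU (u : L) : Uq := piU (iota_T u).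

End TLieAlgebra.

(* -------------------------------------------------------------------- *)
Section Braiding.
Variables (k : comUnitRingType) (q : k) (n : nat).
Local Notation T := (tensalg k (root n)).
Local Notation U := (Uq q n).
Local Notation word := {fmonom root n}.
Local Notation e := (@ebas k n).
Local Notation piU := (@piU k q n).

Definition chi (u v : word) : k :=
  \prod_(x <- (u : seq (root n))) \prod_(y <- (v : seq (root n))) q ^ cartan x y.

Definition sigma_T : tensor T T -> tensor T T :=
  tlift (fun x y =>
    mlin (fun u => mlin (fun v => chi u v *: (tword k v ⊗ tword k u)) y) x).

Definition pi_pi : tensor T T -> tensor U U := tlift (fun x y => piU x ⊗ piU y).

(* Lifts arguments to T, applies sigma_T and projects back; by sigma_pi_pi *)
(* the result does not depend on the chosen lifts.                         *)
Definition sigma : tensor U U -> tensor U U :=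
  tlift (fun a b => pi_pi (sigma_T (arepr a ⊗ arepr b))).

Lemma sigma_T_bilin : bilin (fun x y : T =>
  mlin (fun u => mlin (fun v => chi u v *: (tword k v ⊗ tword k u)) y) x).
Proof.
split=> [y|x]; first exact: mlin_lin.
move=> a y y'; rewrite -mlinZf -mlinDf; apply: eq_bigr => u _; congr (_ *: _).
exact: mlin_lin.
Qed.

Lemma sigma_T_lin : islin sigma_T.
Proof. exact: tlift_lin sigma_T_bilin. Qed.

Lemma sigma_T_word u v :
  sigma_T (tword k u ⊗ tword k v) = chi u v *: (tword k v ⊗ tword k u).
Proof. by rewrite /sigma_T tliftE; [rewrite !mlin1 | exact: sigma_T_bilin]. Qed.

Lemma piU_lin : islin piU. Proof. exact: api_lin. Qed.

Lemma pi_pi_bilin : bilin (fun x y : T => piU x ⊗ piU y).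
Proof.
have [l r] := tens_bilin U U; split=> [y|x].
  exact: islin_comp (l (piU y)) piU_lin.
exact: islin_comp (r (piU x)) piU_lin.
Qed.

Lemma pi_pi_lin : islin pi_pi. Proof. exact: tlift_lin pi_pi_bilin. Qed.

Lemma pi_piE x y : pi_pi (x ⊗ y) = piU x ⊗ piU y.
Proof. exact: tliftE pi_pi_bilin _ _. Qed.

(* ------------------------------------------------------------------ *)
Hypothesis uq : q \is a GRing.unit.

Lemma chi1l v : chi mone v = 1.
Proof. by rewrite /chi fm1 big_nil. Qed.

Lemma chiMl u u' v : chi (mmul u u') v = chi u v * chi u' v.
Proof. by rewrite /chi fmM big_cat. Qed.

Lemma chi_sym u v : chi u v = chi v u.
Proof.
rewrite /chi exchange_big; apply: eq_bigr => x _; apply: eq_bigr => y _.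
by rewrite cartan_sym.
Qed.

Lemma chi1r u : chi u mone = 1.
Proof. by rewrite chi_sym chi1l. Qed.

Lemma chiMr u v v' : chi u (mmul v v') = chi u v * chi u v'.
Proof. by rewrite chi_sym chiMl (chi_sym v) (chi_sym v'). Qed.

Definition twist (w : word) (x : T) : T := mlin (fun u => chi u w *: tword k u) x.

Lemma twist_lin w : islin (twist w). Proof. exact: mlin_lin. Qed.

Lemma twist_word w u : twist w (tword k u) = chi u w *: tword k u.
Proof. exact: mlin1. Qed.

Lemma twistM w x y : twist w (x * y) = twist w x * twist w y.
Proof.
have [l r] := mul_bilin T; move: x.
apply: tensalg_eqlin => [||u]; first exact: islin_comp (twist_lin w) (l y).
  exact: islin_comp (l _) (twist_lin w).
move: y; apply: tensalg_eqlin => [||v].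
- exact: islin_comp (twist_lin w) (r _).
- exact: islin_comp (r _) (twist_lin w).
by rewrite twordM !twist_word -scalerAl -scalerAr scalerA twordM chiMl.
Qed.

Lemma sigma_T_twistl x v : sigma_T (x ⊗ tword k v) = tword k v ⊗ twist v x.
Proof.
have [l r] := tens_bilin T T; move: x; apply: tensalg_eqlin => [||u].
- exact: islin_comp sigma_T_lin (l _).
- exact: islin_comp (r _) (twist_lin v).
by rewrite sigma_T_word twist_word (islinZ (r _)).
Qed.

Lemma sigma_T_twistr u y : sigma_T (tword k u ⊗ y) = twist u y ⊗ tword k u.
Proof.
have [l r] := tens_bilin T T; move: y; apply: tensalg_eqlin => [||v].
- exact: islin_comp sigma_T_lin (r _).
- exact: islin_comp (l _) (twist_lin u).
by rewrite sigma_T_word twist_word (islinZ (l _)) chi_sym.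
Qed.

(* The weight of a word w paired with the i-th coordinate. *)
Definition wt (w : word) (i : 'I_n.+1) : int :=
  \sum_(y <- (w : seq (root n))) ((i == (val y).1)%:R - (i == (val y).2)%:R).

Definition dg (w : word) (x : root n) : int := wt w (val x).1 - wt w (val x).2.

Lemma chi_gen x w : chi (fmu x) w = q ^ dg w x.
Proof.
rewrite /chi fmU big_seq1 /dg /wt -sumrB.
have -> (s : seq (root n)) (f : root n -> int) :
    q ^ (\sum_(y <- s) f y) = \prod_(y <- s) q ^ f y.
  by apply: (big_morph (exprz q)) => [a b|] //; rewrite exprzDr.
apply: eq_bigr => y _; congr (q ^ _); rewrite /cartan.
case: (val x) => i j; case: (val y) => a b /=.
by rewrite (eq_sym i b) (eq_sym j b) opprB !addrA [RHS](ACl (2*3*1*4))%AC.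
Qed.

Definition homog w (d : int) (x : T) := twist w x = q ^ d *: x.

Lemma homogZ w d a x : homog w d x -> homog w d (a *: x).
Proof.
move=> h; rewrite /homog (islinZ (twist_lin w)) h.
exact: scaler_swap.
Qed.

Lemma homogB w d x y : homog w d x -> homog w d y -> homog w d (x - y).
Proof.
by move=> hx hy; rewrite /homog (islinB (twist_lin w)) hx hy scalerBr.
Qed.

Lemma homogM w d d' x y : homog w d x -> homog w d' y -> homog w (d + d') (x * y).
Proof.
move=> hx hy; rewrite /homog twistM hx hy (exprzDr uq).
exact: scaler_mul2.
Qed.

Lemma homog0 w d : homog w d 0.
Proof. by rewrite /homog (islin0 (twist_lin w)) scaler0. Qed.

Lemma homog_eij w (i j : 'I_n.+1) :
  homog w (wt w i - wt w j) (iota_T (eij k i j)).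
Proof.
have [le|lt] := leqP j i.
  by rewrite eij0 // (islin0 (@iota_T_lin k n)); apply: homog0.
have -> : eij k i j = e (Sub (i, j) lt) by [].
by rewrite iota_T_ebas /homog /tgen twist_word chi_gen.
Qed.

Lemma homog_ebas w x : homog w (dg w x) (iota_T (e x)).
Proof. exact: homog_eij. Qed.

Lemma homog_mul_LL w x y : homog w (dg w x + dg w y) (mul_LL (e x ⊗ e y)).
Proof. by rewrite mul_LLE; apply: homogM; apply: homog_ebas. Qed.

Lemma homog_skew w (W : lmodType k) (F : root n -> root n -> W) (f : W -> T) :
  islin f -> (forall x y, homog w (dg w x + dg w y) (f (F x y))) ->
  forall x y, homog w (dg w x + dg w y) (f (skew q F x y)).
Proof.
move=> lf h x y; rewrite /skew; case: ifP => _.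
  by rewrite (islin0 lf); apply: homog0.
case: ifP => _ //; rewrite (islinN lf) (islinZ lf) -scaleNr addrC.
exact: homogZ.
Qed.

Lemma homog_relator w x y :
  homog w (dg w x + dg w y) (uea_relator q (e x ⊗ e y)).
Proof.
rewrite /uea_relator; apply: homogB; last first.
  rewrite /qbracket blift_ebas.
  apply: (homog_skew (f := @iota_T k n)) (@iota_T_lin k n) _ x y => x' y'.
  rewrite /ebas eij_comm ?(valP x') ?(valP y') // (islinB (@iota_T_lin k n)).
  rewrite /dg; case: (val x') => i j; case: (val y') => a b /=.
  apply: homogB; case: eqP => [->|_].
  - by rewrite subrKA; apply: homog_eij.
  - by rewrite (islin0 (@iota_T_lin k n)); apply: homog0.
  - by rewrite addrC subrKA; apply: homog_eij.
  - by rewrite (islin0 (@iota_T_lin k n)); apply: homog0.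
apply: homogB; last first.
  rewrite /qpseudo blift_ebas.
  apply: (homog_skew (f := @mul_LL k n)) (@mul_LL_lin k n) _ x y => x' y'.
  rewrite /pseudo_lt /dg; case: (val x') => i j; case: (val y') => a b /=.
  case: ifP => _; last by rewrite (islin0 (@mul_LL_lin k n)); apply: homog0.
  rewrite (islinZ (@mul_LL_lin k n)) mul_LLE; apply: homogZ.
  have -> : wt w i - wt w j + (wt w a - wt w b)
          = wt w a - wt w j + (wt w i - wt w b).
    by rewrite addrACA [RHS]addrACA [wt w i + _]addrC.
  by apply: homogM; apply: homog_eij.
apply: homogB; first exact: homog_mul_LL.
rewrite /qS blift_ebas /qS_basis; case: eqP => [->|_].
  exact: homog_mul_LL.
by case: ifP => _; rewrite (islinZ (@mul_LL_lin k n)) addrC; apply: homogZ;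
  apply: homog_mul_LL.
Qed.


Lemma uea_ideal_rel x y : uea_ideal q n (uea_relator q (e x ⊗ e y)).
Proof. by move=> I; apply; exists (e x), (e y). Qed.

Section TwistIdeal.
Variable w : word.
Let J (x : T) := uea_ideal q n (twist w x).
Fact twist_ideal0 : J 0.
Proof. by rewrite /J (islin0 (twist_lin w)); apply: imem0. Qed.
Fact twist_idealD x y : J x -> J y -> J (x + y).
Proof. by rewrite /J (islinD (twist_lin w)); apply: imemD. Qed.
Fact twist_idealMl a x : J x -> J (a * x).
Proof. by rewrite /J twistM; apply: imemMl. Qed.
Fact twist_idealMr a x : J x -> J (x * a).
Proof. by rewrite /J twistM; apply: imemMr. Qed.
Definition twist_ideal : ideal T :=
  Ideal twist_ideal0 twist_idealD twist_idealMl twist_idealMr.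

Lemma uea_ideal_twist x : uea_ideal q n x -> uea_ideal q n (twist w x).
Proof.
move=> /(_ twist_ideal); apply=> _ [u [v ->]]; rewrite /= /J.
rewrite tens_basis (islin_sum (@uea_relator_lin k q n)).
rewrite (islin_sum (twist_lin w)); apply: (smem_sum (P := uea_ideal q n)) => i _.
rewrite (islin_sum (@uea_relator_lin k q n)) (islin_sum (twist_lin w)).
apply: (smem_sum (P := uea_ideal q n)) => j _.
rewrite (islinZ (@uea_relator_lin k q n)) (islinZ (twist_lin w)).
rewrite homog_relator; do 2!apply: imemZ; exact: uea_ideal_rel.
Qed.
End TwistIdeal.

Lemma piU_eq0 x : piU x = 0 <-> uea_ideal q n x.
Proof. exact: api_eq0. Qed.

Lemma sigma_T_ideall x y : uea_ideal q n x -> pi_pi (sigma_T (x ⊗ y)) = 0.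
Proof.
have [l r] := tens_bilin T T; have [l' r'] := tens_bilin U U => Ix.
move: y; apply: tensalg_eqlin => [||v].
- exact: islin_comp pi_pi_lin (islin_comp sigma_T_lin (r _)).
- exact: islin_zero.
rewrite sigma_T_twistl pi_piE (piU_eq0 (twist v x)).2 ?(islin0 (r' _)) //.
exact: uea_ideal_twist.
Qed.

Lemma sigma_T_idealr x y : uea_ideal q n y -> pi_pi (sigma_T (x ⊗ y)) = 0.
Proof.
have [l r] := tens_bilin T T; have [l' r'] := tens_bilin U U => Iy.
move: x; apply: tensalg_eqlin => [||u].
- exact: islin_comp pi_pi_lin (islin_comp sigma_T_lin (l _)).
- exact: islin_zero.
rewrite sigma_T_twistr pi_piE (piU_eq0 (twist u y)).2 ?(islin0 (l' _)) //.
exact: uea_ideal_twist.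
Qed.

Lemma sigma_T_congr x x' y y' : piU x = piU x' -> piU y = piU y' ->
  pi_pi (sigma_T (x ⊗ y)) = pi_pi (sigma_T (x' ⊗ y')).
Proof.
have [l r] := tens_bilin T T; move=> /api_eq Ix /api_eq Iy.
transitivity (pi_pi (sigma_T (x' ⊗ y))); apply/subr0_eq.
  rewrite -(islinB pi_pi_lin) -(islinB sigma_T_lin) -(islinB (l y)).
  exact: sigma_T_ideall.
rewrite -(islinB pi_pi_lin) -(islinB sigma_T_lin) -(islinB (r x')).
exact: sigma_T_idealr.
Qed.

Lemma piU_repr (a : U) : piU (arepr a) = a.
Proof. exact: areprK. Qed.

Lemma sigma_bilin :
  bilin (fun a b : U => pi_pi (sigma_T (arepr a ⊗ arepr b))).
Proof.
have [l r] := tens_bilin T T; split=> [b|a] c u v.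
  rewrite -(islinZ pi_pi_lin) -(islinD pi_pi_lin).
  rewrite -(islinZ sigma_T_lin) -(islinD sigma_T_lin) -l.
  by apply: sigma_T_congr => //; rewrite piU_lin !piU_repr.
rewrite -(islinZ pi_pi_lin) -(islinD pi_pi_lin).
rewrite -(islinZ sigma_T_lin) -(islinD sigma_T_lin) -r.
by apply: sigma_T_congr => //; rewrite piU_lin !piU_repr.
Qed.

Lemma sigma_lin : islin sigma. Proof. exact: tlift_lin sigma_bilin. Qed.

Lemma sigma_pi_pi t : sigma (pi_pi t) = pi_pi (sigma_T t).
Proof.
move: t; apply: tens_eqlin => [||x y].
- exact: islin_comp sigma_lin pi_pi_lin.
- exact: islin_comp pi_pi_lin sigma_T_lin.
rewrite pi_piE /sigma (tliftE sigma_bilin).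
by apply: sigma_T_congr; rewrite piU_repr.
Qed.

End Braiding.

(* -------------------------------------------------------------------- *)
Section TwistedProduct.
Variables (k : comUnitRingType) (q : k) (n : nat).
Local Notation U := (Uq q n).

(* The natural U-bimodule structure of U ⊗ U. *)
Definition lact (a : U) : tensor U U -> tensor U U :=
  tlift (fun x y => (a * x) ⊗ y).
Definition ract (t : tensor U U) (d : U) : tensor U U :=
  tlift (fun x y => x ⊗ (y * d)) t.

Definition tw_mul (s t : tensor U U) : tensor U U :=
  tlift (fun a b => tlift (fun c d => lact a (ract (sigma (b ⊗ c)) d)) t) s.

Lemma lact_bilin (a : U) : bilin (fun x y : U => (a * x) ⊗ y).
Proof.
have [l r] := tens_bilin U U; split=> [y|x]; last exact: r.
exact: islin_comp (l y) (mulr_islin a).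
Qed.

Lemma ract_bilin (d : U) : bilin (fun x y : U => x ⊗ (y * d)).
Proof.
have [l r] := tens_bilin U U; split=> [y|x]; first exact: l.
exact: islin_comp (r x) (mull_islin d).
Qed.

Lemma lactE a x y : lact a (x ⊗ y) = (a * x) ⊗ y.
Proof. exact: tliftE (lact_bilin a) _ _. Qed.
Lemma ractE x y d : ract (x ⊗ y) d = x ⊗ (y * d).
Proof. exact: tliftE (ract_bilin d) _ _. Qed.

Lemma lact_lin a : islin (lact a). Proof. exact: tlift_lin (lact_bilin a). Qed.
Lemma ract_lin d : islin (ract^~ d). Proof. exact: tlift_lin (ract_bilin d). Qed.

Lemma lact_linl t : islin (lact^~ t).
Proof.
have [l r] := tens_bilin U U; apply: tlift_param => x y.
exact: islin_comp (l y) (mull_islin x).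
Qed.

Lemma ract_linr t : islin (ract t).
Proof.
have [l r] := tens_bilin U U; apply: tlift_param => x y.
exact: islin_comp (r x) (mulr_islin y).
Qed.

Hypothesis uq : q \is a GRing.unit.

Lemma tw_inner_bilin (a b : U) :
  bilin (fun c d : U => lact a (ract (sigma (b ⊗ c)) d)).
Proof.
have [l r] := tens_bilin U U; split=> [d|c].
  apply: islin_comp (lact_lin a) (islin_comp (ract_lin d) _).
  exact: islin_comp (sigma_lin uq) (r b).
exact: islin_comp (lact_lin a) (ract_linr _).
Qed.

Lemma tw_outer_bilin t :
  bilin (fun a b : U => tlift (fun c d => lact a (ract (sigma (b ⊗ c)) d)) t).
Proof.
have [l r] := tens_bilin U U; split=> [b|a]; apply: tlift_param => c d.
  exact: lact_linl.
apply: islin_comp (lact_lin a) (islin_comp (ract_lin d) _).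
exact: islin_comp (sigma_lin uq) (l c).
Qed.

Lemma tw_mul_linl t : islin (tw_mul^~ t).
Proof. exact: tlift_lin (tw_outer_bilin t). Qed.

Lemma tw_mul_linr s : islin (tw_mul s).
Proof.
by apply: tlift_param => a b; apply: tlift_lin; apply: tw_inner_bilin.
Qed.

Lemma tw_mulE (a b c d : U) :
  tw_mul (a ⊗ b) (c ⊗ d) = lact a (ract (sigma (b ⊗ c)) d).
Proof.
by rewrite /tw_mul (tliftE (tw_outer_bilin _)) (tliftE (tw_inner_bilin a b)).
Qed.

Definition uword (u : {fmonom root n}) : U := piU q (tword k u).

Lemma uwordM u v : uword u * uword v = uword (mmul u v).
Proof. by rewrite /uword -twordM /piU apiM. Qed.

Lemma uword1 : uword mone = 1. Proof. by []. Qed.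

Lemma sigma_word u v : sigma (uword u ⊗ uword v) = chi q u v *: (uword v ⊗ uword u).
Proof.
rewrite -!pi_piE sigma_pi_pi // sigma_T_word (islinZ (@pi_pi_lin k q n)).
by rewrite pi_piE.
Qed.

Lemma tw_mul_word u v u' v' :
  tw_mul (uword u ⊗ uword v) (uword u' ⊗ uword v') =
  chi q v u' *: (uword (mmul u u') ⊗ uword (mmul v v')).
Proof.
rewrite tw_mulE sigma_word (islinZ (ract_lin _)) (islinZ (lact_lin _)).
by rewrite ractE lactE !uwordM.
Qed.

Lemma UU_ind (P : submodule (tensor U U)) :
  (forall u v, P (uword u ⊗ uword v)) -> forall t, P t.
Proof.
have [l r] := tens_bilin U U => h; apply: tens_ind => x y.
rewrite -[x]piU_repr -[y]piU_repr.
move: (arepr x) (arepr y) => {}x {}y.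
have lx := islin_comp (l (piU q y)) (@piU_lin k q n).
apply: (tensalg_ind (P := preim_submodule lx P)) x => u.
rewrite /= /preim_mem /= => {lx}.
have ly := islin_comp (r (uword u)) (@piU_lin k q n).
by apply: (tensalg_ind (P := preim_submodule ly P)) y => v; apply: h.
Qed.

Lemma UU_eqlin (W : lmodType k) (f g : tensor U U -> W) : islin f -> islin g ->
  (forall u v, f (uword u ⊗ uword v) = g (uword u ⊗ uword v)) -> f =1 g.
Proof. by move=> lf lg h; apply: (UU_ind (P := eqlin lf lg)). Qed.

Lemma tw_mulA : associative tw_mul.
Proof.
move=> x y z; move: x; apply: UU_eqlin => [||u1 v1].
- exact: tw_mul_linl.
- exact: islin_comp (tw_mul_linl z) (tw_mul_linl y).
move: y; apply: UU_eqlin => [||u2 v2].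
- exact: islin_comp (tw_mul_linr _) (tw_mul_linl z).
- exact: islin_comp (tw_mul_linl z) (tw_mul_linr _).
move: z; apply: UU_eqlin => [||u3 v3].
- exact: islin_comp (tw_mul_linr _) (tw_mul_linr _).
- exact: tw_mul_linr.
rewrite !tw_mul_word (islinZ (tw_mul_linr _)) (islinZ (tw_mul_linl _)).
rewrite !tw_mul_word (mulmA u1) (mulmA v1); apply: scaler_congr2.
by rewrite chiMr chiMl mulrCA [chi q v2 u3 * _]mulrC.
Qed.

Lemma tw_mul1l : left_id (1 ⊗ 1 : tensor U U) tw_mul.
Proof.
apply: UU_eqlin => [||u v]; [exact: tw_mul_linr | exact: islin_id |].
by rewrite -uword1 tw_mul_word chi1l scale1r !mul1m.
Qed.

Lemma tw_mul1r : right_id (1 ⊗ 1 : tensor U U) tw_mul.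
Proof.
apply: UU_eqlin => [||u v]; [exact: tw_mul_linl | exact: islin_id |].
by rewrite -uword1 tw_mul_word chi1r scale1r !mulm1.
Qed.

Lemma tw_mulDl : left_distributive tw_mul +%R.
Proof. by move=> x y z; apply: (islinD (tw_mul_linl z)). Qed.

Lemma tw_mulDr : right_distributive tw_mul +%R.
Proof. by move=> x y z; apply: (islinD (tw_mul_linr x)). Qed.

Lemma tw_scaleAl (a : k) x y : a *: tw_mul x y = tw_mul (a *: x) y.
Proof. by rewrite (islinZ (tw_mul_linl y)). Qed.

Lemma tw_scaleAr (a : k) x y : a *: tw_mul x y = tw_mul x (a *: y).
Proof. by rewrite (islinZ (tw_mul_linr x)). Qed.

Definition augU (a : U) : k^o := mcoeff mone (arepr a).

Lemma augU_pi x : augU (piU q x) = mcoeff mone x.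
Proof.
apply/subr0_eq; rewrite -[LHS]mcoeff1B; apply: (@uea_ideal_aug k q n).
exact: arepr_api.
Qed.

Lemma augU_lin : islin augU.
Proof.
move=> a x y; rewrite -[x]piU_repr -[y]piU_repr -(@piU_lin k q n) !augU_pi.
by rewrite mcoeffD mcoeffZ.
Qed.

Lemma tw_1neq0 : (1 ⊗ 1 : tensor U U) != 0.
Proof.
have la := augU_lin.
have ba : bilin (fun a b : U => augU a * augU b : k^o).
  split=> [b|a] c u v; rewrite la; first by rewrite mulrDl -scalerAl.
  by rewrite mulrDr scalerAr.
have a1 : augU 1 = 1 by rewrite -[1 in LHS]uword1 augU_pi mcoeffU1 eqxx.
apply/eqP => /(congr1 (tlift (fun a b : U => augU a * augU b : k^o))).
rewrite (tliftE ba) (islin0 (tlift_lin ba)) a1 mulr1.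
by apply/eqP; apply: oner_neq0.
Qed.

End TwistedProduct.

(* U ⊗ U with the twisted multiplication. The invertibility of q, needed   *)
(* for sigma to be well defined, is a parameter of the type.                *)
Definition UqUq (k : comUnitRingType) (q : k) (n : nat)
  (uq : q \is a GRing.unit) : Type := tensor (Uq q n) (Uq q n).

Section TwistedAlgebra.
Variables (k : comUnitRingType) (q : k) (n : nat).
Hypothesis uq : q \is a GRing.unit.
Local Notation UU := (UqUq n uq).

HB.instance Definition _ := GRing.Lmodule.on UU.
HB.instance Definition _ := GRing.Zmodule_isNzRing.Build UU
  (@tw_mulA k q n uq) (@tw_mul1l k q n uq) (@tw_mul1r k q n uq)
  (@tw_mulDl k q n uq) (@tw_mulDr k q n uq) (@tw_1neq0 k q n).
HB.instance Definition _ :=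
  GRing.Lmodule_isLalgebra.Build k UU (@tw_scaleAl k q n uq).
HB.instance Definition _ :=
  GRing.Lalgebra_isAlgebra.Build k UU (@tw_scaleAr k q n uq).

Definition utens (a b : Uq q n) : UU := a ⊗ b.

Lemma utensM (a b c d : Uq q n) :
  utens a b * utens c d = lact a (ract (sigma (b ⊗ c)) d) :> tensor _ _.
Proof. exact: tw_mulE. Qed.

End TwistedAlgebra.

(* Main.v *)
(* Write E_i = e_{i(i+1)}. All e_ij arise from the E_i by
   e_{i(j+1)} = e_ij E_j - q^-1 E_j e_ij, and, with these elements, all defining
   relations of U follow from four families: far commutation, the two q-Serre
   relations e12 e13 = q e13 e12 and e13 e23 = q e23 e13, and e14 e23 = e23 e14
   (all up to a shift of the indices). The others imply the last one only
   up to the factor q + q^-1, which may be a zero divisor. Thus it suffices to check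
   the four families for F_i = E_i ⊗ 1 + 1 ⊗ E_i. In U ⊗ U the elements
   X_i = E_i ⊗ 1 and Y_i = 1 ⊗ E_i satisfy Y_i X_j = q^{a_ij} X_j Y_i with
   (a_ij) the Cartan matrix, which gives
     e13(F) = e13(X) + e13(Y) + (1 - q^-2) X1 Y2,
     e14(F) = e14(X) + e14(Y) + (1 - q^-2) (e13(X) Y3 + X1 e24(Y)),
   and the four checks become short computations with q-commutators. *)
Require Import Defs.
From HB Require Import structures.
From mathcomp Require Import all_boot all_order all_algebra.
From mathcomp Require Import finmap monalg.
From mathcomp Require Import zify.

Set Implicit Arguments.
Unset Strict Implicit.
Unset Printing Implicit Defensive.

(* Defs is imported again because its root is shadowed by poly.root. *)
Import GRing.Theory Defs.

Local Open Scope ring_scope.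

(** * Calculus of q-commutators *)

Section QCommutation.
Variables (k : comNzRingType) (A : algType k).
Implicit Types (c d e : k) (x y z : A).

Definition qcomm c x y := x * y = c *: (y * x).

Definition qbr c x y := x * y - c *: (y * x).

Lemma qbr_eq0 c x y : qcomm c x y -> qbr c x y = 0.
Proof. by move=> h; rewrite /qbr h subrr. Qed.

Lemma qcomm_eq c d x y : qcomm c x y -> c = d -> qcomm d x y.
Proof. by move=> h <-. Qed.

Lemma qcomm0l c x : qcomm c 0 x.
Proof. by rewrite /qcomm mulr0 mul0r scaler0. Qed.

Lemma qcomm0r c x : qcomm c x 0.
Proof. by rewrite /qcomm mulr0 mul0r scaler0. Qed.

Lemma qcomm1_refl x : qcomm 1 x x.
Proof. by rewrite /qcomm scale1r. Qed.

Lemma qcomm_sym c d x y : d * c = 1 -> qcomm c x y -> qcomm d y x.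
Proof. by move=> dc h; rewrite /qcomm h scalerA dc scale1r. Qed.

Lemma qcomm1_sym x y : qcomm 1 x y -> qcomm 1 y x.
Proof. by apply: qcomm_sym; rewrite mulr1. Qed.

Lemma qcommMr c d x y z :
  qcomm c x y -> qcomm d x z -> qcomm (c * d) x (y * z).
Proof.
move=> hy hz; rewrite /qcomm mulrA hy -scalerAl -[y * x * z]mulrA hz -scalerAr.
by rewrite scalerA mulrA.
Qed.

Lemma qcommMl c d x y z :
  qcomm c x z -> qcomm d y z -> qcomm (c * d) (x * y) z.
Proof.
move=> hx hy; rewrite /qcomm -mulrA hy -scalerAr [x * (z * y)]mulrA hx.
rewrite -scalerAl scalerA.
by rewrite [d * c]mulrC -!mulrA.
Qed.

Lemma qcommDr c x y z : qcomm c x y -> qcomm c x z -> qcomm c x (y + z).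
Proof. by rewrite /qcomm mulrDl mulrDr scalerDr => -> ->. Qed.

Lemma qcommDl c x y z : qcomm c x z -> qcomm c y z -> qcomm c (x + y) z.
Proof. by rewrite /qcomm mulrDl mulrDr scalerDr => -> ->. Qed.

(** Moving [x] past [y * z] or past [z * y] costs the same factor [c * d]. *)
Lemma qcomm_qbrr c d e x y z :
  qcomm c x y -> qcomm d x z -> qcomm (c * d) x (qbr e y z).
Proof.
move=> hy hz; have h1 := qcommMr hy hz; have h2 := qcommMr hz hy.
rewrite /qcomm /qbr mulrBr mulrBl -scalerAr -scalerAl h1 h2.
by rewrite scalerBr !scalerA [d * c]mulrC [c * d * e]mulrC.
Qed.

Lemma qcomm_qbrl c d e x y z :
  qcomm c x z -> qcomm d y z -> qcomm (c * d) (qbr e x y) z.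
Proof.
move=> hx hy; have h1 := qcommMl hx hy; have h2 := qcommMl hy hx.
rewrite /qcomm /qbr mulrBr mulrBl -scalerAr -scalerAl h1 h2.
by rewrite scalerBr !scalerA [d * c]mulrC [c * d * e]mulrC.
Qed.

Lemma qcomm1_qbrr c e x y z : qcomm c x y -> qcomm 1 x z -> qcomm c x (qbr e y z).
Proof. by move=> hy hz; have := qcomm_qbrr e hy hz; rewrite mulr1. Qed.

Lemma qcomm1_qbrl c e x y z : qcomm c x z -> qcomm 1 y z -> qcomm c (qbr e x y) z.
Proof. by move=> hy hz; have := qcomm_qbrl e hy hz; rewrite mulr1. Qed.

Lemma qbrDl c x y z : qbr c (x + y) z = qbr c x z + qbr c y z.
Proof. by rewrite /qbr mulrDl mulrDr scalerDr opprD addrACA. Qed.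

Lemma qbrDr c x y z : qbr c x (y + z) = qbr c x y + qbr c x z.
Proof. by rewrite /qbr mulrDl mulrDr scalerDr opprD addrACA. Qed.

Lemma qbrZl c d x y : qbr c (d *: x) y = d *: qbr c x y.
Proof. by rewrite /qbr -scalerAl -scalerAr scaler_swap -scalerBr. Qed.

Lemma qbrZr c d x y : qbr c x (d *: y) = d *: qbr c x y.
Proof. by rewrite /qbr -scalerAl -scalerAr scaler_swap -scalerBr. Qed.

(** A q-Leibniz rule whose other term, [qbr c x y * z], vanishes by hypothesis. *)
Lemma qbrMr c d x y z : qcomm c x y -> qbr (c * d) x (y * z) = c *: (y * qbr d x z).
Proof.
move=> h; rewrite /qbr mulrA h -!mulrA mulrBr scalerBr -scalerAl -mulrA.
by rewrite -scalerAr scalerA.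
Qed.

Lemma qbrMl c d x y z : qcomm c y z -> qbr (c * d) (x * y) z = c *: (qbr d x z * y).
Proof.
move=> h; rewrite /qbr -mulrA h -scalerAr mulrBl scalerBr -scalerAl scalerA.
by rewrite !mulrA.
Qed.

Lemma qbrMl_out c d x y z : qcomm d z x -> qbr c (x * y) z = x * qbr (c * d) y z.
Proof.
move=> h; rewrite /qbr [z * (x * y)]mulrA h mulrBr -scalerAl -scalerAr scalerA.
by rewrite !mulrA.
Qed.

Lemma qbr_qcomm c d x y : qcomm d y x -> qbr c x y = (1 - c * d) *: (x * y).
Proof. by rewrite /qbr => ->; rewrite scalerA scalerBl scale1r. Qed.

Lemma qbr_swap c d x y : c * d = 1 -> qbr c y x = - (c *: qbr d x y).
Proof. by move=> cd; rewrite /qbr scalerBr scalerA cd scale1r opprB. Qed.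

Lemma qcommP c x y : qbr c x y = 0 -> qcomm c x y.
Proof. by move/subr0_eq. Qed.

(* Jacobi identity when the outer entries commute. *)
Lemma qbrA c x y z : qcomm 1 x z -> qbr c (qbr c x y) z = qbr c x (qbr c y z).
Proof.
rewrite /qcomm scale1r => xz; rewrite /qbr !mulrBl !mulrBr -!scalerAl -!scalerAr.
rewrite !mulrA -xz -[y * x * z]mulrA xz mulrA !scalerBr !opprB.
by rewrite addrACA [RHS]addrACA; congr (_ + _); rewrite addrC.
Qed.

(** The source of the pseudobracket. With [w = qbr d x z], substituting [x * z = w + d *: (z * x)]
    leaves [w] twice: as [c *: (y * w)] and as [- d *: (w * y)], where [w] and [y] commute. *)
Lemma qbr_cross c d x y z : c * d = 1 -> qcomm c x y -> qcomm 1 (qbr d x z) y ->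
  x * qbr d y z = qbr d y z * x + (c - d) *: (y * qbr d x z).
Proof.
move=> cd xy; rewrite /qcomm scale1r; set w := qbr d x z => wy.
have xz : x * z = w + d *: (z * x) by rewrite subrK.
rewrite mulrBr -scalerAr mulrA xy -scalerAl -[y * x * z]mulrA xz mulrA xz.
rewrite mulrDr mulrDl wy -scalerAr -!scalerAl -[z * x * y]mulrA xy -scalerAr.
rewrite !scalerDr !scalerA cd scale1r -[d * d * c]mulrA [d * c]mulrC cd mulr1.
rewrite mulrBl scalerBl -scalerAl !mulrA opprD addrACA addrC.
by congr (_ + _).
Qed.

End QCommutation.

(** * Root vectors and the quantum Serre relations *)

Section RootVectors.
Variables (k : comUnitRingType) (q : k) (A : algType k).

(* e_ij built from the E i; the value for j <= i is the junk 0. *)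
Fixpoint rootvec (E : nat -> A) (i j : nat) : A :=
  if j isn't j'.+1 then 0 else
  if i == j' then E i else qbr q^-1 (rootvec E i j') (E j').

(** The sequence [E] is infinite; finitely many generators are extended by 0. Expanded, [serre_l]
    and [serre_r] are the two cubic q-Serre relations. *)
Record serre (E : nat -> A) : Prop := Serre {
  serre_far : forall i j, (i.+1 < j)%N -> qcomm 1 (E i) (E j);
  serre_l : forall i, qcomm q (E i) (rootvec E i i.+2);
  serre_r : forall i, qcomm q (rootvec E i i.+2) (E i.+1);
  serre_mid : forall i, qcomm 1 (rootvec E i i.+3) (E i.+1) }.

(* The exponent is cartan (i, j) (a, b). *)
Definition root_rel (e : nat -> nat -> A) (i j a b : nat) : Prop :=
  e i j * e a b =
  q ^ (- (b == i)%:R + (b == j)%:R + (i == a)%:R - (j == a)%:R)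
    *: (e a b * e i j)
  + (if [&& i < a, a < j & j < b]%N then (q - q^-1) *: (e a j * e i b) else 0)
  + (if j == a then e i b else 0).

Definition root_rels (e : nat -> nat -> A) : Prop := forall i j a b : nat,
  (i < j)%N -> (a < b)%N ->
  ((i + j < a + b) || (i + j == a + b) && (j < b))%N -> root_rel e i j a b.

(** If [b > n], every term has a factor with second index [b]. If [b <= n < j], the products with
    [e i j] vanish and the conditions of the last two terms fail. *)
Lemma root_rels_trunc n (e : nat -> nat -> A) :
  (forall i j a b : nat, (i < j <= n)%N -> (a < b <= n)%N ->
    ((i + j < a + b) || (i + j == a + b) && (j < b))%N -> root_rel e i j a b) ->
  root_rels (fun i j => if (j <= n)%N then e i j else 0).
Proof.
move=> h i j a b ij ab lt; have := h i j a b; rewrite /root_rel ij ab /=.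
have [bn|nb] := leqP b n; last first.
  by rewrite mulr0 mul0r !(mulr0, scaler0) !if_same !addr0.
have [jn|nj] := leqP j n; first by apply.
have [-> ->] : (a < j < b)%N = false /\ (j == a) = false by lia.
by rewrite mul0r mulr0 andbF scaler0 !addr0.
Qed.

Lemma rootvec_simple E i : rootvec E i i.+1 = E i.
Proof. by rewrite /= eqxx. Qed.

Lemma rootvecS E i j : (i < j)%N ->
  rootvec E i j.+1 = qbr q^-1 (rootvec E i j) (E j).
Proof. by move=> ij; rewrite /= ltn_eqF. Qed.

Lemma rootvec_eq0 E i j : (j <= i)%N -> rootvec E i j = 0.
Proof.
elim: j => //= j IHj ji; rewrite gtn_eqF // IHj ?(ltnW ji) //.
by rewrite /qbr mul0r mulr0 scaler0 subr0.
Qed.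

Lemma qcomm_rootvec E z i j : (forall l, (i <= l < j)%N -> qcomm 1 z (E l)) ->
  qcomm 1 z (rootvec E i j).
Proof.
elim: j => [_|j IHj h]; first exact: qcomm0r.
have [ji|ij|ij] := ltngtP j i; first by rewrite rootvec_eq0 //; apply: qcomm0r.
  rewrite rootvecS //; apply: qcomm1_qbrr; last by apply: h; lia.
  by apply: IHj => l ?; apply: h; lia.
by subst j; rewrite rootvec_simple; apply: h; lia.
Qed.

(** * From the Serre relations to all root relations *)

Section Relations.
Variable E : nat -> A.
Hypothesis sE : serre E.
Local Notation e := (rootvec E).

Lemma serre_far_sym i j : (i.+1 < j)%N -> qcomm 1 (E j) (E i).
Proof. by move/(serre_far sE)/qcomm1_sym. Qed.

Lemma rootvec_disjoint i j a b : (j < a)%N -> qcomm 1 (e i j) (e a b).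
Proof.
move=> ja; apply: qcomm_rootvec => l ?; apply: qcomm1_sym.
by apply: qcomm_rootvec => m ?; apply: serre_far_sym; lia.
Qed.

(** Induction on [b]: appending [E b] is an instance of the Jacobi identity [qbrA], since [e i j]
    and [E b] commute when [j < b]. *)
Lemma rootvec_br i j b : (i < j < b)%N -> qbr q^-1 (e i j) (e j b) = e i b.
Proof.
case/andP=> ij; elim: b => // b IHb; rewrite ltnS leq_eqVlt => /predU1P[<-|jb].
  by rewrite rootvec_simple rootvecS.
rewrite !rootvecS ?(ltn_trans ij jb) // -qbrA ?IHb // -[E b]rootvec_simple.
exact: rootvec_disjoint.
Qed.

(** [serre_mid] is the case [i = m - 1], [j = m + 2]. The interval then grows to the right and to
    the left by elements far from [E m]. *)
Lemma rootvec_nested_simple i m j : (i < m)%N -> (m.+1 < j)%N ->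
  qcomm 1 (E m) (e i j).
Proof.
case: m => // m im mj.
have H : qcomm 1 (E m.+1) (e m j).
  elim: j mj => // j IHj; rewrite ltnS leq_eqVlt => /predU1P[<-|mj].
    exact/qcomm1_sym/serre_mid.
  rewrite rootvecS; last by lia.
  by apply: qcomm1_qbrr; [apply: IHj | apply: (serre_far sE); lia].
move: im; rewrite ltnS leq_eqVlt => /predU1P[->//|im].
rewrite -(@rootvec_br i m); last by lia.
apply: qcomm1_qbrr => //; apply: qcomm_rootvec => l ?.
by apply: serre_far_sym; lia.
Qed.

Lemma rootvec_nested i j a b : (i < a)%N -> (b < j)%N -> qcomm 1 (e i j) (e a b).
Proof.
move=> ia bj; apply: qcomm_rootvec => l ?; apply: qcomm1_sym.
by apply: rootvec_nested_simple; lia.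
Qed.

(** [serre_l] is the shortest case. Raising [b] appends generators far from [E i]; raising [j]
    appends generators that commute with [e i b] by nesting. *)
Lemma rootvec_row i j b : (i < j < b)%N -> qcomm q (e i j) (e i b).
Proof.
case/andP; elim: j => // j IHj; rewrite ltnS leq_eqVlt => /predU1P[<-{IHj}|ij] jb.
  rewrite rootvec_simple; elim: b jb => // b IHb; rewrite ltnS leq_eqVlt.
  case/predU1P=> [<-|ib]; first exact: serre_l.
  rewrite rootvecS; last by lia.
  by apply: qcomm1_qbrr; [apply: IHb | exact: (serre_far sE)].
rewrite rootvecS //; apply: qcomm1_qbrl; first by apply: IHj => //; lia.
exact: rootvec_nested_simple.
Qed.

(** Mirror image of [rootvec_row]. The case [a = j - 1] comes from [serre_r] by splitting [e i j] at
    [j - 2]; lowering [a] adds a factor nested in [e i j]. *)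
Lemma rootvec_col i a j : (i < a < j)%N -> qcomm q (e i j) (e a j).
Proof.
case: j => [|j]; first by lia.
case/andP=> ia aj.
have H : qcomm q (e i j.+1) (E j).
  case: j aj => [|j] aj; first by lia.
  have [lt|ge] := ltnP i j; last by have -> : i = j by [lia]; apply: serre_r.
  rewrite -(@rootvec_br i j); last by lia.
  apply: (qcomm_eq _ (mul1r q)); apply: qcomm_qbrl; last exact: serre_r.
  by rewrite -[E _]rootvec_simple; apply: rootvec_disjoint.
move: aj; rewrite ltnS leq_eqVlt => /predU1P[->|aj].
  by rewrite rootvec_simple.
rewrite (rootvecS _ aj); apply: (qcomm_eq _ (mul1r q)); apply: qcomm_qbrr => //.
exact: rootvec_nested.
Qed.

Hypothesis uq : q \is a GRing.unit.

(** This is [qbr_cross] for [x = e i j], [y = e a j], [z = e j b], [c = q] and [d = q^-1], because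
    [e a b] and [e i b] both split at [j]. *)
Lemma rootvec_cross i a j b : (i < a)%N -> (a < j)%N -> (j < b)%N ->
  e i j * e a b = e a b * e i j + (q - q^-1) *: (e a j * e i b).
Proof.
move=> ia aj jb.
rewrite -[e a b](@rootvec_br a j) ?aj // -[e i b](@rootvec_br i j); last by lia.
have h1 : qcomm q (e i j) (e a j) by apply: rootvec_col; lia.
have h2 : qcomm 1 (qbr q^-1 (e i j) (e j b)) (e a j).
  by rewrite rootvec_br; [apply: rootvec_nested | lia].
apply: qbr_cross => //; exact: mulrV.
Qed.

Lemma rootvec_rels : root_rels e.
Proof.
move=> i j a b ij ab lt; rewrite /root_rel.
have simp := (mulr0n, mulr1n, oppr0, addr0, add0r).
 (* If [b = i], then [a < i] and [b < j], against the order. *)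
 have -> : (b == i) = false by lia.
have [ja|aj|/eqP ja] := ltngtP j a.
- have [-> ->] : (b == j) = false /\ (i == a) = false by lia.
  by rewrite andbF !simp expr0z; apply: rootvec_disjoint.
(* For [a <= i] the order forces [j < b]. *)
- have [ia|ai|eia] := ltngtP i a; last first.
  + subst i; have -> : (b == j) = false by lia.
    by rewrite /= !simp expr1z; apply: rootvec_row; lia.
  + have -> : (b == j) = false by lia.
    rewrite /= !simp expr0z; apply: qcomm1_sym.
    by apply: rootvec_nested; lia.
  have [jb|bj|ejb] := ltngtP j b; rewrite /= !simp.
  + by rewrite expr0z scale1r; apply: rootvec_cross.
  + by rewrite expr0z; apply: rootvec_nested.
  by subst b; rewrite expr1z; apply: rootvec_col; lia.
move/eqP: ja => ja; subst a.
have [-> ->] : (b == j) = false /\ (i == j) = false by lia.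
rewrite andbF !simp exprN1 -(@rootvec_br i j b) ?ij //.
by rewrite addrC subrK.
Qed.
End Relations.

(** * The Serre relations for [X i + Y i] *)

Section Coproduct.
Hypothesis uq : q \is a GRing.unit.
Variables X Y : nat -> A.
Hypotheses (sX : serre X) (sY : serre Y).
(* The exponents are the entries of the Cartan matrix of type A. *)
Hypothesis YX_diag : forall i, qcomm (q ^+ 2) (Y i) (X i).
Hypothesis YX_next : forall i, qcomm q^-1 (Y i) (X i.+1).
Hypothesis YX_prev : forall i, qcomm q^-1 (Y i.+1) (X i).
Hypothesis YX_far : forall i j, (i.+1 < j)%N -> qcomm 1 (Y i) (X j).
Hypothesis YX_far' : forall i j, (i.+1 < j)%N -> qcomm 1 (Y j) (X i).

Let F i := X i + Y i.
Let qV : q * q^-1 = 1. Proof. exact: mulrV. Qed.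

Lemma rootvec2E E i : rootvec E i i.+2 = qbr q^-1 (E i) (E i.+1).
Proof. by rewrite rootvecS ?rootvec_simple. Qed.

Lemma rootvec_coprod2 i : rootvec F i i.+2 =
  rootvec X i i.+2 + rootvec Y i i.+2 + (1 - q^-1 * q^-1) *: (X i * Y i.+1).
Proof.
rewrite !rootvec2E !(qbrDl, qbrDr) (qbr_eq0 (YX_next i)).
by rewrite (qbr_qcomm _ (YX_prev i)) add0r addrAC.
Qed.

Lemma rootvec_coprod3 i : rootvec F i i.+3 =
  rootvec X i i.+3 + rootvec Y i i.+3
  + (1 - q^-1 * q^-1) *: (rootvec X i i.+2 * Y i.+2 + X i * rootvec Y i.+1 i.+3).
Proof.
rewrite rootvecS // rootvec_coprod2 [F i.+2]/F !(qbrDl, qbrDr) !qbrZl.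
have h1 : qcomm q^-1 (Y i.+2) (rootvec X i i.+2).
  rewrite rootvec2E; apply: qcomm_eq (qcomm_qbrr _ _ _) (mul1r _) => //.
  exact: YX_far'.
have h2 : qcomm q^-1 (rootvec Y i i.+2) (X i.+2).
  rewrite rootvec2E; apply: qcomm_eq (qcomm_qbrl _ _ _) (mul1r _) => //.
  exact: YX_far.
have h3 : qcomm q^-1 (X i * Y i.+1) (X i.+2).
  apply: qcomm_eq (qcommMl _ _) (mul1r _) => //.
  exact: serre_far.
(* The mixed brackets with [X i.+2] vanish. Those with [Y i.+2] remain: one is a multiple of a
   product, and from the other [X i] factors out. *)
rewrite (qbr_qcomm _ h1) (qbr_eq0 h2) (qbr_eq0 h3).
rewrite (qbrMl_out _ _ (YX_far' _)) // mulr1 -rootvec2E -!rootvecS //.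
rewrite scaler0 !add0r scalerDr [RHS]addrA; congr (_ + _); exact: addrAC.
Qed.

Lemma serre_coprod : serre F.
Proof.
have q2V : q ^+ 2 * q^-1 = q by rewrite expr2 mulrK.
(* In each q-Serre relation two terms survive, with coefficients [1 - q * q] and the left side here,
   so they cancel. *)
have lq2 : (1 - q^-1 * q^-1) * q ^+ 2 = - (1 - q * q).
  by rewrite mulrBl mul1r expr2 mulrACA mulVr // mulr1 opprB.
have Vq : q^-1 * q = 1 by rewrite mulVr.
have XY_prev i : qcomm q (X i) (Y i.+1) := qcomm_sym qV (YX_prev i).
(* In these names 1 stands for [i]: y13 is [rootvec Y i i.+2] and x2 is [X i.+1]. The exponents are
   sums of Cartan entries. *)
have y13x1 i : qcomm q (rootvec Y i i.+2) (X i).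
  by rewrite rootvec2E; apply: qcomm_eq (qcomm_qbrl _ _ _) q2V.
have y13x2 i : qcomm q (rootvec Y i i.+2) (X i.+1).
  rewrite rootvec2E; apply: qcomm_eq (qcomm_qbrl _ _ _) _; [by [] | by [] |].
  by rewrite mulrC.
have y1x13 i : qcomm q (Y i) (rootvec X i i.+2).
  by rewrite rootvec2E; apply: qcomm_eq (qcomm_qbrr _ _ _) q2V.
have y2x13 i : qcomm q (Y i.+1) (rootvec X i i.+2).
  rewrite rootvec2E; apply: qcomm_eq (qcomm_qbrr _ _ _) _; [by [] | by [] |].
  by rewrite mulrC.
have y2x14 i : qcomm 1 (Y i.+1) (rootvec X i i.+3).
  by rewrite rootvecS //; apply: qcomm_eq (qcomm_qbrr _ _ _) qV.
have y14x2 i : qcomm 1 (rootvec Y i i.+3) (X i.+1).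
  by rewrite rootvecS //; apply: qcomm_eq (qcomm_qbrl _ _ _) qV.
split=> [i j ij|i|i|i].
- apply: qcommDl; apply: qcommDr; first exact: serre_far.
  + exact/qcomm1_sym/YX_far'.
  + exact: YX_far.
  exact: serre_far.
- apply: qcommP; rewrite rootvec_coprod2 [F i]/F !(qbrDl, qbrDr, qbrZl, qbrZr).
  rewrite (qbr_eq0 (serre_l sX i)) (qbr_eq0 (serre_l sY i)) (qbr_eq0 (y1x13 i)).
  rewrite (qbr_qcomm _ (y13x1 i)).
  rewrite (qbr_eq0 (qcomm_eq (qcommMr (qcomm1_refl (X i)) (XY_prev i)) (mul1r q))).
have -> : qbr q (Y i) (X i * Y i.+1) = q ^+ 2 *: (X i * rootvec Y i i.+2).
    by rewrite rootvec2E -(qbrMr _ _ (YX_diag i)) q2V.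
  by rewrite scaler0 !(add0r, addr0) scalerA -scalerDl lq2 subrr scale0r.
- apply: qcommP; rewrite rootvec_coprod2 [F i.+1]/F !(qbrDl, qbrDr, qbrZl, qbrZr).
  rewrite (qbr_eq0 (serre_r sX i)) (qbr_eq0 (serre_r sY i)) (qbr_eq0 (y13x2 i)).
  rewrite (qbr_qcomm _ (y2x13 i)).
  rewrite (qbr_eq0 (qcomm_eq (qcommMl (XY_prev i) (qcomm1_refl _)) (mulr1 q))).
  have -> : qbr q (X i * Y i.+1) (X i.+1) = q ^+ 2 *: (rootvec X i i.+2 * Y i.+1).
    by rewrite rootvec2E -(qbrMl _ _ (YX_diag _)) q2V.
  by rewrite scaler0 !(add0r, addr0) scalerA -scalerDl lq2 subrr scale0r.
- rewrite rootvec_coprod3; apply: qcommP; rewrite [F i.+1]/F.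
  rewrite !(qbrDl, qbrDr, qbrZl, qbrZr).
  rewrite (qbr_eq0 (serre_mid sX i)) (qbr_eq0 (serre_mid sY i)).
  rewrite (qbr_eq0 (qcomm1_sym (y2x14 i))) (qbr_eq0 (y14x2 i)).
  rewrite (qbr_eq0 (qcomm_eq (qcommMl (serre_r sX i) (YX_prev _)) qV)).
  (* Two brackets contribute: e13(X) Y3 with Y2, and X1 e24(Y) with X2. They equal -q and q times
     e13(X) e24(Y). *)
  rewrite (qbrMl_out _ _ (y2x13 i)) mul1r (qbr_swap _ _ qV).
  have -> : qbr 1 (X i * rootvec Y i.+1 i.+3) (X i.+1) =
            q *: (rootvec X i i.+2 * rootvec Y i.+1 i.+3).
    by rewrite [rootvec X _ _]rootvec2E -(qbrMl _ _ (y13x1 _)) qV.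
  have y24y2 := qcomm_sym Vq (serre_l sY i.+1).
  rewrite (qbr_eq0 (qcomm_eq (qcommMl (XY_prev i) y24y2) qV)) -rootvec2E.
  rewrite mulrN -scalerAr !(add0r, addr0) -scalerDr subrr.
  exact: scaler0.
Qed.

End Coproduct.

(** * From the root relations back to the Serre relations *)

(** The relations with [j = a] identify [e i j] with the root vectors of the [e i i.+1]; the four
    families are then instances of [root_rels]. *)
Lemma serre_root_rels (e : nat -> nat -> A) :
  root_rels e -> serre (fun i => e i i.+1).
Proof.
move=> h; set E := fun i => e i i.+1.
have simp := (mulr0n, mulr1n, oppr0, addr0, add0r).
have br i j b : (i < j < b)%N -> qbr q^-1 (e i j) (e j b) = e i b.
  case/andP=> ij jb; rewrite /qbr (h _ _ _ _) //; last by lia.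
  have [-> -> ->] : [/\ (b == i) = false, (b == j) = false & (i == j) = false].
    by split; lia.
  by rewrite eqxx ltnn andbF !simp exprN1 addrC addKr.
have rv i j : (i < j)%N -> rootvec E i j = e i j.
  elim: j => // j IHj; rewrite ltnS leq_eqVlt => /predU1P[<-|ij].
    by rewrite rootvec_simple.
  by rewrite rootvecS // IHj // br // ij /=.
split=> [i j ij|i|i|i]; rewrite ?rv /qcomm //; try by lia.
- have [f1 f2] : (j.+1 == i) = false /\ (j.+1 == i.+1) = false by lia.
  have [f3 f4 f5] : [/\ (i == j) = false, (i.+1 == j) = false &
                     (j < i.+1)%N = false].
    by split; lia.
  by rewrite (h _ _ _ _) ?f1 ?f2 ?f3 ?f4 ?f5 ?andbF ?mulr0n ?oppr0 ?addr0 ?expr0z //;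
    lia.
- rewrite (h _ _ _ _) ?ltnn ?eqxx //; try lia.
  have [-> -> ->] : [/\ (i.+2 == i) = false, (i.+2 == i.+1) = false &
                      (i.+1 == i) = false].
    by split; lia.
  by rewrite !simp expr1z.
- rewrite (h _ _ _ _) ?ltnn ?eqxx ?andbF //; try lia.
  have [-> -> ->] : [/\ (i.+2 == i) = false, (i == i.+1) = false &
                      (i.+2 == i.+1) = false].
    by split; lia.
  by rewrite !simp expr1z.
(* Both index sums are [2 * i + 3]; the tie-break puts [(i.+1, i.+2)] before [(i, i.+3)]. *)
apply: qcomm1_sym; rewrite /qcomm (h _ _ _ _) //; try by lia.
have [-> -> ->] : [/\ (i.+3 == i.+1) = false, (i.+3 == i.+2) = false &
                    (i.+1 == i) = false].
  by split; lia.
have [-> ->] : (i.+2 == i) = false /\ (i.+1 < i)%N = false by lia.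
by rewrite !simp expr0z.
Qed.
End RootVectors.

Lemma serre_morph (k : comUnitRingType) (q : k) (A B : algType k)
    (f : A -> B) (E : nat -> A) :
  islin f -> {morph f : x y / x * y} -> serre q E -> serre q (f \o E).
Proof.
move=> lf fM [h1 h2 h3 h4].
have fq c x y : qcomm c x y -> qcomm c (f x) (f y).
  by rewrite /qcomm -!fM -(islinZ lf) => ->.
have fr i j : rootvec q (f \o E) i j = f (rootvec q E i j).
  elim: j => [|j IHj] /=; first by rewrite (islin0 lf).
  by case: eqP => // _; rewrite IHj /qbr /= (islinB lf) (islinZ lf) !fM.
by split=> *; rewrite ?fr; apply: fq; auto.
Qed.

(** * Ordered relations and the universal property of U *)

Section Relators.
Variables (k : comUnitRingType) (q : k) (n : nat).
Hypothesis uq : q \is a GRing.unit.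
Local Notation T := (tensalg k (root n)).
Local Notation e := (@ebas k n).

Lemma uea_relator_lt (x y : root n) : rlt x y ->
  uea_relator q (e x ⊗ e y) =
  let: (i, j) := val x in let: (a, b) := val y in
  iota_T (eij k i j) * iota_T (eij k a b)
  - q ^ cartan x y *: (iota_T (eij k a b) * iota_T (eij k i j))
  - (if [&& i < a, a < j & j < b]%N then
       (q - q^-1) *: (iota_T (eij k a j) * iota_T (eij k i b)) else 0)
  - iota_T (if j == a then eij k i b else 0).
Proof.
move=> lt; rewrite /uea_relator qbracket_le ?lt ?orbT // qpseudo_lt // qS_lt //.
rewrite (islinZ (@mul_LL_lin k n)) !mul_LLE /ebas.
rewrite eij_comm ?(valP x) ?(valP y) //.
move: lt (valP x) (valP y); rewrite /rlt /pseudo_lt.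
case: (val x) (val y) => [i j] [a b] /= lt ij ab.
have -> : (b == i) = false by rewrite -val_eqE /=; lia.
rewrite subr0; congr (_ - _ - _); case: ifP => _.
  by rewrite (islinZ (@mul_LL_lin k n)) mul_LLE.
exact: islin0 (@mul_LL_lin k n).
Qed.

Lemma uea_relator_diag x : uea_relator q (e x ⊗ e x) = 0.
Proof.
rewrite /uea_relator qS_diag qpseudo_diag qbracket_le ?eqxx // subrr.
rewrite (islin0 (@mul_LL_lin k n)) subr0 sub0r.
have -> : sut_comm (e x) (e x) = 0 by apply: val_inj; rewrite /= subrr.
by rewrite (islin0 (@iota_T_lin k n)) oppr0.
Qed.

(** As S is an involution, it exchanges the first two terms; both brackets change sign. *)
Lemma uea_relator_qS (t : tensor (sut k n) (sut k n)) :
  uea_relator q (qS q t) = - uea_relator q t.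
Proof.
rewrite /uea_relator qS_invol // qpseudo_S // qbracket_S //.
rewrite (islinN (@mul_LL_lin k n)) (islinN (@iota_T_lin k n)).
have H (a b c d : T) : b - a - - c - - d = - (a - b - c - d).
  by rewrite !opprD !opprK (addrC b).
exact: H.
Qed.

(** By antisymmetry, a relator with [y < x] is a unit multiple of the one for the reversed pair;
    diagonal relators are 0. *)
Lemma uea_relator_eq0 (W : lmodType k) (g : T -> W) : islin g ->
  (forall x y, rlt x y -> g (uea_relator q (e x ⊗ e y)) = 0) ->
  forall t : tensor (sut k n) (sut k n), g (uea_relator q t) = 0.
Proof.
move=> lg h; apply: LL_eqlin => [||x y].
- exact: islin_comp lg (@uea_relator_lin k q n).
- exact: islin_zero.
have [<-|nxy] := eqVneq x y; first by rewrite uea_relator_diag (islin0 lg).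
have [/h //|/(rlt_total nxy) yx] := boolP (rlt x y).
have H (r r' : T) (c d : k) : d * c = 1 -> c *: r = - r' -> g r' = 0 -> g r = 0.
  move=> dc cr r'0; rewrite -[r]scale1r -dc -scalerA cr (islinZ lg) (islinN lg).
  by rewrite r'0 oppr0 scaler0.
apply: (H _ _ (q ^ cartan y x) (q ^ (- cartan y x)) _ _ (h y x yx)).
  by rewrite -exprzDr // addNr expr0z.
rewrite -uea_relator_qS qS_lt //; apply: esym.
exact: (islinZ (@uea_relator_lin k q n)).
Qed.

(** The linear extension of [r] lifts to T, and the kernel of the lift is an ideal containing all
    relators once it contains the ordered ones. The vanishing of [r] for [j <= i] matches [eij]. *)
Lemma uea_lift (A : algType k) (r : nat -> nat -> A) :
  (forall i j, (j <= i)%N -> r i j = 0) -> root_rels q r ->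
  exists phi : {lrmorphism Uq q n -> A},
    forall i j : 'I_n.+1, phi (inU q (eij k i j)) = r i j.
Proof.
move=> r0 hr; pose f (u : sut k n) : A :=
  \sum_x coord u x *: r (val x).1 (val x).2.
have lf : islin f.
  move=> a u v; rewrite /f scaler_sumr -big_split; apply: eq_bigr => x _ /=.
  by rewrite coord_lin scalerDl scalerA.
have fE (i j : 'I_n.+1) : f (eij k i j) = r i j.
  have [le|lt] := leqP j i; first by rewrite eij0 // (islin0 lf) r0.
  pose x : root n := Sub (i, j) lt; rewrite -[eij k i j]/(e x) /f (bigD1 x) //=.
  rewrite coord_ebas eqxx scale1r big1 ?addr0 // => y.
  by rewrite coord_ebas eq_sym => /negPf ->; rewrite scale0r.
have [g gf _] := tensalg_universal lf.
have lg : islin g by move=> a x y; rewrite linearP.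
have gM (i j a b : 'I_n.+1) :
    g (iota_T (eij k i j) * iota_T (eij k a b)) = r i j * r a b.
  by rewrite -!fE -!gf; apply: rmorphM.
have gif (C : bool) c (i j a b : 'I_n.+1) :
    g (if C then c *: (iota_T (eij k i j) * iota_T (eij k a b)) else 0) =
    if C then c *: (r i j * r a b) else 0.
  by case: C; [rewrite -gM; apply: islinZ | apply: islin0].
have gt (C : bool) (i j : 'I_n.+1) :
    g (iota_T (if C then eij k i j else 0)) = if C then r i j else 0.
  by rewrite gf; case: C; [apply: fE | apply: islin0].
have g_eq0 (x y z t : T) (c : k) (x' y' z' t' : A) : g x = x' -> g y = y' ->
    g z = z' -> g t = t' -> x' = c *: y' + z' + t' -> g (x - c *: y - z - t) = 0.
  move=> <- <- <- <-; rewrite !(islinB lg) (islinZ lg) => ->.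
  by rewrite -(addrA (c *: _)) [c *: _ + _]addrC addrK [_ + g t]addrC addrK subrr.
have grel (t : tensor (sut k n) (sut k n)) : g (uea_relator q t) = 0.
  apply: (uea_relator_eq0 lg) => x y lt; rewrite uea_relator_lt //.
  move: (valP x) (valP y) lt; rewrite /rlt /cartan.
  case: (val x) (val y) => [i j] [a b] /= ij ab lt.
  apply: g_eq0 (gM _ _ _ _) (gM _ _ _ _) (gif _ _ _ _ _ _) (gt _ _ _) _.
  exact: hr.
have gMM u v : g (u * v) = g u * g v := rmorphM g u v.
have K0 : g 0 = 0 := islin0 lg.
have KD (x y : T) : g x = 0 -> g y = 0 -> g (x + y) = 0.
  by rewrite (islinD lg) => -> ->; rewrite addr0.
have KMl (a x : T) : g x = 0 -> g (a * x) = 0.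
  by rewrite gMM => ->; rewrite mulr0.
have KMr (a x : T) : g x = 0 -> g (x * a) = 0.
  by rewrite gMM => ->; rewrite mul0r.
(* [arepr] picks a lift to T; [phi_pi] shows that the choice is immaterial. *)
pose phi (a : Uq q n) : A := g (arepr a).
have phi_pi x : phi (piU q x) = g x.
  apply/subr0_eq; rewrite -(islinB lg).
  have /(_ (Ideal K0 KD KMl KMr)) := @arepr_api k T (uea_ideal q n) x.
  by apply=> _ [u [v ->]]; apply: grel.
have lphi : islin phi.
  move=> c a b; rewrite -[a]piU_repr -[b]piU_repr -(@piU_lin k q n) !phi_pi.
  exact: lg.
have phi1 : phi 1 = 1 := etrans (phi_pi 1) (rmorph1 g).
have phiM : {morph phi : a b / a * b}.
  move=> a b; rewrite -[a]piU_repr -[b]piU_repr /piU -apiM !phi_pi.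
  exact: rmorphM.
have phiB : zmod_morphism phi by move=> x y; apply: islinB.
have phiMM : monoid_morphism phi by [].
have phiZ : scalable phi by move=> c x; apply: islinZ.
pose pa := GRing.isZmodMorphism.Build (Uq q n) A phi phiB.
pose pm := GRing.isMonoidMorphism.Build (Uq q n) A phi phiMM.
pose ps := GRing.isScalable.Build k (Uq q n) A *:%R phi phiZ.
pose Phi : {lrmorphism Uq q n -> A} := HB.pack phi pa pm ps.
by exists Phi => i j; rewrite /= /inU phi_pi gf fE.
Qed.


Lemma inU_rel (i j a b : 'I_n.+1) : (i < j)%N -> (a < b)%N ->
  ((i + j < a + b) || (i + j == a + b) && (j < b))%N ->
  inU q (eij k i j) * inU q (eij k a b) =
  q ^ (- (b == i :> nat)%:R + (b == j :> nat)%:R + (i == a :> nat)%:R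
       - (j == a :> nat)%:R) *: (inU q (eij k a b) * inU q (eij k i j))
  + (if [&& i < a, a < j & j < b]%N then
       (q - q^-1) *: (inU q (eij k a j) * inU q (eij k i b)) else 0)
  + (if j == a :> nat then inU q (eij k i b) else 0).
Proof.
move=> ij ab lt; pose x : root n := Sub (i, j) ij; pose y : root n := Sub (a, b) ab.
have lp := @piU_lin k q n.
have pM u v : piU q (iota_T u * iota_T v) = inU q u * inU q v :> Uq q n.
  exact: apiM.
have pP (C : bool) c u v : piU q (if C then c *: (iota_T u * iota_T v) else 0) =
    if C then c *: (inU q u * inU q v) else 0 :> Uq q n.
  by case: C; [rewrite -pM; apply: islinZ | apply: islin0].
have pI (C : bool) u : piU q (iota_T (if C then u else 0)) =
    if C then inU q u else 0 :> Uq q n.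
  by case: C => //; rewrite (islin0 (@iota_T_lin k n)); apply: islin0.
have p_eq (u v w t : T) (c : k) (u' v' w' t' : Uq q n) : piU q u = u' ->
    piU q v = v' -> piU q w = w' -> piU q t = t' ->
    piU q (u - c *: v - w - t) = 0 -> u' = c *: v' + w' + t'.
  move=> <- <- <- <-; rewrite !(islinB lp) (islinZ lp) => /eqP.
  by rewrite !subr_eq add0r => /eqP ->; rewrite addrC (addrC (piU q t)) addrA.
have xy : rlt x y by [].
have /piU_eq0 := @uea_ideal_rel k q n x y; rewrite uea_relator_lt //=.
exact: p_eq (pM _ _) (pM _ _) (pP _ _ _ _) (pI _ _).
Qed.

(* Extended by 0 beyond n, so that relations need no upper bound on indices. *)
Definition rootU (i j : nat) : Uq q n :=
  if (j <= n)%N then inU q (eij k (inord i) (inord j)) else 0.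

Lemma rootU_rels : root_rels q rootU.
Proof.
apply: root_rels_trunc => i j a b /andP[ij jn] /andP[ab bn] lt.
have ord m : (m <= n)%N -> exists m' : 'I_n.+1, m = m'.
  by move=> mn; exists (inord m); rewrite inordK.
have [i' ei] := ord i ltac:(lia); have [j' ej] := ord j jn.
have [a' ea] := ord a ltac:(lia); have [b' eb] := ord b bn.
subst i j a b; rewrite /root_rel !inord_val; exact: inU_rel.
Qed.

(** * The two copies of U inside U ⊗ U *)

Local Notation U := (Uq q n).

Lemma inU_ebas x : inU q (e x) = uword q (fmu x).
Proof. by rewrite /inU iota_T_ebas. Qed.

Lemma utensl_lin : islin (fun a : U => utens uq a 1).
Proof. by have [l _] := tens_bilin U U; apply: l. Qed.

Lemma utensr_lin : islin (utens uq (1 : U)).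
Proof. by have [_ r] := tens_bilin U U; apply: r. Qed.

(** The empty word has trivial [chi] with every word. This makes [a ↦ a ⊗ 1] multiplicative. *)
Lemma sigma1l (a : U) : sigma (1 ⊗ a) = a ⊗ 1.
Proof.
have [l r] := tens_bilin U U; rewrite -[a]piU_repr; move: (arepr a).
have lp := @piU_lin k q n.
apply: tensalg_eqlin => [||u].
- exact: islin_comp (sigma_lin uq) (islin_comp (r 1) lp).
- exact: islin_comp (l 1) lp.
by rewrite -[1](@uword1 k q n) sigma_word // chi1l scale1r.
Qed.

Lemma sigma1r (a : U) : sigma (a ⊗ 1) = 1 ⊗ a.
Proof.
have [l r] := tens_bilin U U; rewrite -[a]piU_repr; move: (arepr a).
have lp := @piU_lin k q n.
apply: tensalg_eqlin => [||u].
- exact: islin_comp (sigma_lin uq) (islin_comp (l 1) lp).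
- exact: islin_comp (r 1) lp.
by rewrite -[1](@uword1 k q n) sigma_word // chi1r scale1r.
Qed.

Lemma utenslM : {morph (fun a : U => utens uq a 1) : a b / a * b}.
Proof. by move=> a b; rewrite utensM sigma1l ractE lactE mulr1. Qed.

Lemma utensrM : {morph utens uq (1 : U) : a b / a * b}.
Proof. by move=> a b; rewrite utensM sigma1r ractE lactE mulr1. Qed.

(** (1 ⊗ x)(y ⊗ 1) is σ(x ⊗ y), while (y ⊗ 1)(1 ⊗ x) is y ⊗ x. *)
Lemma utens_comm (x y : root n) :
  qcomm (q ^ cartan x y) (utens uq 1 (inU q (e x))) (utens uq (inU q (e y)) 1).
Proof.
rewrite /qcomm !inU_ebas -[1](@uword1 k q n).
have -> : utens uq (uword q (fmu y)) (uword q mone) *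
          utens uq (uword q mone) (uword q (fmu x)) =
          utens uq (uword q (fmu y)) (uword q (fmu x)).
  apply: (etrans (tw_mul_word uq _ _ _ _)).
  by rewrite chi1l scale1r mulm1 mul1m.
apply: (etrans (tw_mul_word uq _ _ _ _)).
by rewrite mulm1 mul1m /chi !fmU !big_seq1.
Qed.

Definition simple (i : nat) : U := rootU i i.+1.

Lemma serre_simple : serre q simple.
Proof. exact: serre_root_rels rootU_rels. Qed.

(** The exponent is an entry of the Cartan matrix of type A. For an index at least [n] one factor is
    0. *)
Lemma utens_simple_comm (i j : nat) (c : int) :
  (2 * (i == j)%:R - (i.+1 == j)%:R - (j.+1 == i)%:R)%R = c ->
  qcomm (q ^ c) (utens uq 1 (simple i)) (utens uq (simple j) 1).
Proof.
move=> <-; rewrite /simple /rootU; have [ni|ni] := ltnP i n; last first.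
  by rewrite (islin0 utensr_lin); apply: qcomm0l.
have [nj|nj] := ltnP j n; last by rewrite (islin0 utensl_lin); apply: qcomm0r.
have lt m : (m < n)%N -> ((inord m : 'I_n.+1) < (inord m.+1 : 'I_n.+1))%N.
  by move=> mn; rewrite !inordK // ltnS ltnW.
pose x m mn : root n := Sub (inord m, inord m.+1) (lt m mn).
apply: qcomm_eq (utens_comm (x i ni) (x j nj)) _; congr (q ^ _).
rewrite /cartan /= -!val_eqE /= !inordK ?ltnS // ?(ltnW ni) ?(ltnW nj) //.
rewrite eqSS. lia.
Qed.

End Relators.

Theorem theorem2p5 (k : comUnitRingType) (q : k) (uq : q \is a GRing.unit)
  (n : nat) (hn : (1 <= n)%N) :
  exists phi : {lrmorphism Uq q n -> UqUq n uq},
    forall i j : 'I_n.+1, (j = i.+1 :> nat) ->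
      phi (inU q (eij k i j)) =
        utens uq (inU q (eij k i j)) 1 + utens uq 1 (inU q (eij k i j)).
Proof.
pose E := @simple k q n.
pose F i := utens uq (E i) 1 + utens uq 1 (E i).
have sF : serre q F.
  apply: serre_coprod => // [||i|i|i|i j ij|i j ij].
  - exact: serre_morph (utensl_lin _) (utenslM _) (serre_simple _ _).
  - exact: serre_morph (utensr_lin _) (utensrM _) (serre_simple _ _).
  - by rewrite exprnP; apply: utens_simple_comm; lia.
  - by rewrite -exprN1; apply: utens_simple_comm; lia.
  - by rewrite -exprN1; apply: utens_simple_comm; lia.
  - by rewrite -(expr0z q); apply: utens_simple_comm; lia.
  - by rewrite -(expr0z q); apply: utens_simple_comm; lia.
(* [phi] sends e_ij to the root vector of [F], hence e_{i(i+1)} to [F i]. *)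
have [phi phiE] :=
  @uea_lift k q n uq _ _ (@rootvec_eq0 _ q _ F) (rootvec_rels sF uq).
exists phi => i j ij; rewrite phiE ij rootvec_simple /F /E /simple /rootU.
(* Since [j] is an ordinal, [i.+1 <= n], so [rootU] does not take its default value. *)
by rewrite -ij -ltnS ltn_ord !inord_val.
Qed.
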